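(* Let $(M,g,\psi)$ be a nearly Kähler six-manifold, let $A$ be a connection on a principal bundle $\mathcal P\to M$, let $\epsilon$ be a section of $\mathrm{Ad}_{\mathcal P}\otimes T^*M$, let $t\in\mathbb R$, and let $D^{t,A}$ be the Dirac operator constructed from the connections $\nabla^t$ and $A$. Then $\epsilon$ satisfies $$\mathrm d^A\epsilon\cdot\psi=0\quad\text{and}\quad \mathrm d^A{\ast}\epsilon=0$$ if and only if $$D^{t,A}(\epsilon\cdot\psi)=2\,\epsilon\cdot\psi .$$
   Context: Clifford multiplication satisfies $v\cdot v=-|v|^2$, and differential forms act on spinors through the vector space isomorphism $\Lambda^*V\cong \mathrm{Cl}(V,g)$ sending $e^{a_1}\wedge\dots\wedge e^{a_k}$ to $e^{a_1}\cdots e^{a_k}$ for an orthonormal basis and distinct indices. The real spinor bundle $SM$ in dimension six has rank 8, with a fibre metric for which Clifford multiplication by vectors is skew-adjoint. A nearly Kähler six-manifold $(M,g,\psi)$ is a connected oriented six-dimensional Riemannian spin manifold with a unit-length section $\psi$ of $SM$ satisfying $\nabla^{LC}_X\psi=\tfrac12 X\cdot\psi$ for all vector fields $X$. The forms $P\in\Omega^3(M)$, $Q\in\Omega^4(M)$ are defined by $8\,\psi\otimes\psi^T=1+P-Q$ in $SM\otimes SM^*\cong \mathrm{Cl}(M)\cong\Lambda^*M$. For $t\in\mathbb R$, $\nabla^t$ is the metric connection $g(\nabla^t_XY,Z)=g(\nabla^{LC}_XY,Z)+\tfrac t2P(X,Y,Z)$, acting on spinors by $\nabla^t_X\eta=\nabla^{LC}_X\eta+\tfrac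 t4(\iota_XP)\cdot\eta$. $\mathrm{Ad}_{\mathcal P}$ is the adjoint bundle; $\nabla^{t,A}$ is the connection on $SM\otimes\mathrm{Ad}_{\mathcal P}$ induced by $\nabla^t$ and $A$, and $D^{t,A}=\sum_ae^a\cdot\nabla^{t,A}_{a}$ for a local orthonormal frame $e^a$. In $\epsilon\cdot\psi\in\Gamma(SM\otimes\mathrm{Ad}_{\mathcal P})$ and $\mathrm d^A\epsilon\cdot\psi$, the form parts act on $\psi$ by Clifford multiplication. *)

(* Defs.v *)
(* MathComp-Analysis; R : realType is the field of real numbers. *)
From HB Require Import structures.
From mathcomp Require Import all_boot all_order all_algebra.
From mathcomp Require Import all_classical all_reals all_analysis.

Set Implicit Arguments.
Unset Strict Implicit.
Unset Printing Implicit Defensive.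

Import Order.TTheory GRing.Theory Num.Theory.
Import numFieldNormedType.Exports.

Local Open Scope classical_set_scope.
Local Open Scope ring_scope.

(* Every fibre of every bundle below is a concrete coordinate space, identified
   with R^r separately at each base point, with no continuity required of the
   identification; the smooth structure of the bundle is carried by its local
   frames.  A section is thus a function from the base to R^r, and sections
   over an open set are functions defined everywhere of which only the
   restriction to that open set matters. *)

Section Manifolds.
Context {R : realType}.

(* On an open subset U of a finite-dimensional space. *)
Fixpoint Ck {V W : normedModType R} (k : nat) (U : set V) (f : V -> W) : Prop :=
  if k is k'.+1 then
    (forall x, U x -> differentiable f x) /\
    (forall v, Ck k' U (fun x => 'D_v f x))
  else forall x, U x -> {for x, continuous f}.

Definition smooth_near {V W : normedModType R} (f : V -> W) (x : V) : Prop :=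
  exists2 U : set V, open_nbhs x U & forall k, Ck k U f.

Record chart (T : topologicalType) (n : nat) := Chart {
  cdom : set T;
  chart_map :> T -> 'rV[R]_n;
  point_of : 'rV[R]_n -> T;
  cdom_open : open cdom;
  cimage_open : open (chart_map @` cdom);
  chart_mapK : forall x, cdom x -> point_of (chart_map x) = x;
  chart_map_continuous : forall x, cdom x -> {for x, continuous chart_map};
  point_of_continuous :
    forall u, (chart_map @` cdom) u -> {for u, continuous point_of} }.

(* The atlas is the family of the charts chart_at x.  The chart at x also fixes
   the identification of the tangent space at x with R^n. *)
Record manifold (n : nat) := Manifold {
  mpoint :> topologicalType;
  chart_at : mpoint -> chart mpoint n;
  chart_at_dom : forall x, cdom (chart_at x) x;
  transition_smooth : forall a b x,
    cdom (chart_at a) x -> cdom (chart_at b) x ->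
    smooth_near (fun u => chart_at b (point_of (chart_at a) u)) (chart_at a x);
  mhausdorff : hausdorff_space mpoint;
  msecond_countable : @second_countable mpoint }.

Definition in_chart {n} {M : manifold n} {W : Type} (p : M) (f : M -> W) :
  'rV[R]_n -> W := fun u => f (point_of (chart_at p) u).

Definition smooth_at {n} {M : manifold n} {W : normedModType R}
    (f : M -> W) (p : M) : Prop :=
  smooth_near (in_chart p f) (chart_at p p).

(* The derivative at p, in the direction of the tangent vector v. *)
Definition dir_deriv {n} {M : manifold n} {W : normedModType R}
    (p : M) (v : 'rV[R]_n) (f : M -> W) : W :=
  'D_v (in_chart p f) (chart_at p p).

Definition smooth_map_at {m n} {M : manifold m} {N : manifold n}
    (F : M -> N) (p : M) : Prop :=
  {for p, continuous F} /\ smooth_at (fun x => chart_at (F p) (F x)) p.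

(* Smoothness at (p, q) of a map defined on the product manifold M * N. *)
Definition smooth_map2_at {m n k} {M : manifold m} {N : manifold n}
    {Q : manifold k} (F : M -> N -> Q) (p : M) (q : N) : Prop :=
  {for (p, q), continuous (fun z : M * N => F z.1 z.2)} /\
  smooth_near (fun z : 'rV[R]_m * 'rV[R]_n =>
      chart_at (F p q)
        (F (point_of (chart_at p) z.1) (point_of (chart_at q) z.2)))
    (chart_map (chart_at p) p, chart_map (chart_at q) q).

Definition tmap {m n} {M : manifold m} {N : manifold n} (F : M -> N) (p : M)
    (v : 'rV[R]_m) : 'rV[R]_n :=
  dir_deriv p v (fun x => chart_at (F p) (F x)).

(* Row i is the value at x of the i-th coordinate vector field of the chart at
   c; it is meaningful for x in the domain of that chart. *)
Definition tframe {n} {M : manifold n} (c x : M) : 'M[R]_n :=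
  \matrix_(i < n) 'D_(delta_mx 0 i) (in_chart c (chart_at x)) (chart_at c x).

(* The components of X in the coordinate frame of the chart at c. *)
Definition components {n} {M : manifold n} (X : M -> 'rV[R]_n) (c x : M) :
  'rV[R]_n := X x *m invmx (tframe c x).

Definition smooth_field {n} {M : manifold n} (X : M -> 'rV[R]_n) (p : M) :
  Prop :=
  smooth_at (components X p) p.

(* [X, Y]^i = X(Y^i) - Y(X^i) in coordinates. *)
Definition lie_bracket {n} {M : manifold n} (X Y : M -> 'rV[R]_n) (p : M) :
  'rV[R]_n :=
  dir_deriv p (X p) (components Y p) - dir_deriv p (Y p) (components X p).

(* Covariant derivatives nab p v s of sections s that are smooth near p; sm is
   the smoothness of sections of the bundle, whose fibres are W. *)
Record linear_connection {n} {M : manifold n} {W : normedModType R}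
    (sm : (M -> W) -> M -> Prop)
    (nab : M -> 'rV[R]_n -> (M -> W) -> W) : Prop := LinearConnection {
  conn_dir : forall p s a v w, sm s p ->
    nab p (a *: v + w) s = a *: nab p v s + nab p w s;
  conn_add : forall p v s s', sm s p -> sm s' p ->
    nab p v (fun x => s x + s' x) = nab p v s + nab p v s';
  conn_leibniz : forall p v f s, smooth_at (f : M -> R^o) p -> sm s p ->
    nab p v (fun x => f x *: s x) =
    dir_deriv p v (f : M -> R^o) *: s p + f p *: nab p v s;
  conn_smooth : forall p X s, smooth_field X p -> sm s p ->
    sm (fun x => nab x (X x) s) p }.

End Manifolds.

Arguments chart R T n : clear implicits.
Arguments manifold R n : clear implicits.

Section PrincipalBundles.
Context {R : realType}.

Record lie_group (m : nat) := LieGroup {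
  lie_manifold :> manifold R m;
  lone : lie_manifold;
  lmul : lie_manifold -> lie_manifold -> lie_manifold;
  linv : lie_manifold -> lie_manifold;
  lmulA : forall a b c, lmul a (lmul b c) = lmul (lmul a b) c;
  lmul1 : forall a, lmul lone a = a;
  lmulV : forall a, lmul (linv a) a = lone;
  lmul_smooth : forall a b, smooth_map2_at lmul a b;
  linv_smooth : forall a, smooth_map_at linv a }.

(* The Lie algebra is the tangent space 'rV_m at the identity. *)
Definition Ad {m} {G : lie_group m} (a : G) (xi : 'rV[R]_m) : 'rV[R]_m :=
  tmap (fun b => lmul (lmul a b) (linv a)) (lone G) xi.

(* Around each c, p |-> (bproj p, tcoord c p) is the local trivialization over
   tdom c, with inverse (x, a) |-> tsec c x . a. *)
Record principal_bundle {n m} (M : manifold R n) (G : lie_group m) :=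
  PrincipalBundle {
  ptotal : manifold R (n + m);
  bproj : ptotal -> M;
  ract : ptotal -> G -> ptotal;
  bproj_smooth : forall p, smooth_map_at bproj p;
  ract_smooth : forall p a, smooth_map2_at ract p a;
  ract1 : forall p, ract p (lone G) = p;
  ractM : forall p a b, ract p (lmul a b) = ract (ract p a) b;
  bproj_ract : forall p a, bproj (ract p a) = bproj p;
  tdom : M -> set M;
  tdom_nbhs : forall c, open_nbhs c (tdom c);
  tsec : M -> M -> ptotal;
  tsec_smooth : forall c x, tdom c x -> smooth_map_at (tsec c) x;
  tsecK : forall c x, tdom c x -> bproj (tsec c x) = x;
  tcoord : M -> ptotal -> G;
  tcoord_smooth : forall c p, tdom c (bproj p) -> smooth_map_at (tcoord c) p;
  tcoordK : forall c p, tdom c (bproj p) ->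
    ract (tsec c (bproj p)) (tcoord c p) = p;
  ract_tsecK : forall c x a, tdom c x -> tcoord c (ract (tsec c x) a) = a }.

(* A connection as a smooth equivariant horizontal lift
   T_(bproj p) M -> T_p P, a right inverse of the differential of bproj. *)
Record principal_connection {n m} {M : manifold R n} {G : lie_group m}
    (P : principal_bundle M G) := PrincipalConnection {
  hlift : ptotal P -> {linear 'rV[R]_n -> 'rV[R]_(n + m)};
  hlift_bproj : forall p v, tmap (@bproj _ _ _ _ P) p (hlift p v) = v;
  hlift_equivariant : forall p a v,
    tmap (fun q => ract q a) p (hlift p v) = hlift (ract p a) v;
  hlift_smooth : forall p (X : M -> 'rV[R]_n), smooth_field X (bproj p) ->
    smooth_field (fun q => hlift q (X (bproj q))) p }.

Section AdjointBundle.
Context {n m : nat} {M : manifold R n} {G : lie_group m}.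
Variable P : principal_bundle M G.

(* The fibre at x of the adjoint bundle P x_G g is identified with the Lie
   algebra g by xi |-> [tsec x x, xi], where [p . a, xi] = [p, Ad a xi].  The
   section s of the adjoint bundle corresponds to the equivariant function
   ad_fun s : P -> g such that s (bproj q) = [q, ad_fun s q]. *)
Definition ad_fun (s : M -> 'rV[R]_m) : ptotal P -> 'rV[R]_m := fun q =>
  Ad (linv (tcoord (bproj q) q)) (s (bproj q)).

Definition smooth_ad (s : M -> 'rV[R]_m) (x : M) : Prop :=
  smooth_at (ad_fun s) (tsec P x x).

(* The induced covariant derivative: the derivative of the equivariant function
   along the horizontal lift. *)
Definition nabla_ad (A : principal_connection P) (x : M) (v : 'rV[R]_n)
    (s : M -> 'rV[R]_m) : 'rV[R]_m :=
  dir_deriv (tsec P x x) (hlift A (tsec P x x) v) (ad_fun s).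

End AdjointBundle.
End PrincipalBundles.

Arguments lie_group R m : clear implicits.

Section Forms.
Context {R : realType}.

Definition alternating {n k : nat} {W : lmodType R}
    (w : ('I_k -> 'rV[R]_n) -> W) : Prop :=
  (forall (i : 'I_k) (v : 'I_k -> 'rV[R]_n) (a : R) (u u' : 'rV[R]_n),
     w (fun j => if j == i then a *: u + u' else v j) =
     a *: w (fun j => if j == i then u else v j) +
     w (fun j => if j == i then u' else v j)) /\
  (forall (v : 'I_k -> 'rV[R]_n) i j, i != j -> v i = v j -> w v = 0).

Definition contract {n k : nat} {W : lmodType R} (u : 'rV[R]_n)
    (w : ('I_k.+1 -> 'rV[R]_n) -> W) : ('I_k -> 'rV[R]_n) -> W :=
  fun v => w (fun i => oapp v u (unlift ord0 i)).

Section AdValued.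
Context {n m : nat} {M : manifold R n} {G : lie_group R m}.
Variable P : principal_bundle M G.

(* Smooth k-forms with values in the adjoint bundle. *)
Definition ad_form {k} (w : M -> ('I_k -> 'rV[R]_n) -> 'rV[R]_m) : Prop :=
  (forall x, alternating (w x)) /\
  (forall p (X : 'I_k -> M -> 'rV[R]_n), (forall i, smooth_field (X i) p) ->
     smooth_ad P (fun x => w x (fun i => X i x)) p).

(* Koszul's formula
     (d^A w)(X_0, .., X_k) =
       \sum_i (-1)^i nabla^A_(X_i) (w (.., X_i omitted, ..))
       + (terms in the brackets [X_i, X_j])
   at the point x, for the vector fields X_i = \sum_a (v_i)^a d/dx^a with
   constant components in the chart at x, whose brackets vanish. *)
Definition dA {k} (A : principal_connection P)
    (w : M -> ('I_k -> 'rV[R]_n) -> 'rV[R]_m) :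
  M -> ('I_k.+1 -> 'rV[R]_n) -> 'rV[R]_m := fun x v =>
  \sum_(i < k.+1) (-1) ^+ i *:
    nabla_ad A x (v i) (fun y => w y (fun j => v (lift i j) *m tframe x y)).

End AdValued.
End Forms.

Section Riemannian.
Context {R : realType}.

(* onb x is some oriented orthonormal basis (the rows) of the tangent space at
   x, chosen separately at each point: it represents the orientation and, in
   the definitions below, serves to write sums over orthonormal bases whose
   value does not depend on the basis.  onb_oriented says that it has the same
   orientation as, or the opposite orientation to, the frame of the chart at p
   throughout a neighbourhood of p. *)
Record oriented_riemannian {n} (M : manifold R n) := OrientedRiemannian {
  metric : M -> 'M[R]_n;
  metric_sym : forall x, (metric x)^T = metric x;
  metric_pos : forall x (v : 'rV[R]_n),
    v != 0 -> 0 < (v *m metric x *m v^T) 0 0;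
  metric_smooth : forall p : M,
    smooth_at (fun x => tframe p x *m metric x *m (tframe p x)^T) p;
  onb : M -> 'M[R]_n;
  onb_orthonormal : forall x, onb x *m metric x *m (onb x)^T = 1%:M;
  onb_oriented : forall p : M, \forall x \near p,
    0 < \det (onb p) * \det (onb x) * \det (tframe p x) }.

Context {n : nat} {M : manifold R n}.
Variable g : oriented_riemannian M.

Definition gdot (x : M) (v w : 'rV[R]_n) : R := (v *m metric g x *m w^T) 0 0.

Definition vol (x : M) (v : 'I_n -> 'rV[R]_n) : R :=
  \det ((\matrix_(i < n) v i) *m invmx (onb g x)).

Record levi_civita := LeviCivita {
  lc :> M -> 'rV[R]_n -> (M -> 'rV[R]_n) -> 'rV[R]_n;
  lc_connection : linear_connection smooth_field lc;
  lc_metric : forall p v Y Z, smooth_field Y p -> smooth_field Z p ->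
    dir_deriv p v ((fun x => gdot x (Y x) (Z x)) : M -> R^o) =
    gdot p (lc p v Y) (Z p) + gdot p (Y p) (lc p v Z);
  lc_torsion_free : forall p X Y, smooth_field X p -> smooth_field Y p ->
    lc p (X p) Y - lc p (Y p) X = lie_bracket X Y p }.

End Riemannian.

(* The Hodge dual of a 1-form alpha is the contraction of the volume form with
   the vector dual to alpha, so that alpha /\ *alpha = |alpha|^2 vol. *)
Definition hodge1 {R : realType} {k : nat} {M : manifold R k.+1}
    (g : oriented_riemannian M) {W : lmodType R}
    (w : M -> ('I_1 -> 'rV[R]_k.+1) -> W) : M -> ('I_k -> 'rV[R]_k.+1) -> W :=
  fun x v => \sum_(a < k.+1)
    contract (row a (onb g x)) (vol g x : _ -> R^o) v *:
    w x (fun=> row a (onb g x)).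

Section Spinors.
Context {R : realType} {M : manifold R 6}.

(* Cl(6), with v.v = -|v|^2, is isomorphic to M_8(R), whose automorphisms are
   inner; a Euclidean bundle of rank 8 with skew-adjoint Clifford
   multiplication therefore has for symmetries covering SO(6) exactly Spin(6),
   and is the real spinor bundle of a unique spin structure.  A spin structure
   is given here by its spinor bundle.
   The fibres are identified isometrically with the Euclidean space R^8 of
   columns; the columns of sframe c are a smooth orthonormal frame over
   sdom c. *)
Record spinor_bundle (g : oriented_riemannian M) := SpinorBundle {
  sdom : M -> set M;
  sdom_nbhs : forall c, open_nbhs c (sdom c);
  sframe : M -> M -> 'M[R]_8;
  sframe_orthonormal : forall c x, sdom c x ->
    (sframe c x)^T *m sframe c x = 1%:M;
  sframe_smooth : forall a b x, sdom a x -> sdom b x ->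
    smooth_at (fun y => invmx (sframe a y) *m sframe b y) x;
  clif : M -> {linear 'rV[R]_6 -> 'M[R]_8};
  clif_sq : forall x v, clif x v *m clif x v = - (gdot g x v v)%:M;
  clif_skew : forall x v, (clif x v)^T = - clif x v;
  clif_smooth : forall p (X : M -> 'rV[R]_6) (i : 'I_8), smooth_field X p ->
    smooth_at (fun x =>
      invmx (sframe p x) *m clif x (X x) *m col i (sframe p x)) p }.

Context {g : oriented_riemannian M}.
Variable S : spinor_bundle g.

Definition smooth_spinor (eta : M -> 'cV[R]_8) (p : M) : Prop :=
  smooth_at (fun x => invmx (sframe S p x) *m eta x) p.

(* The Levi-Civita connection on spinors. *)
Record spin_connection (D : levi_civita g) := SpinConnection {
  snab :> M -> 'rV[R]_6 -> (M -> 'cV[R]_8) -> 'cV[R]_8;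
  snab_connection : linear_connection smooth_spinor snab;
  snab_metric : forall p v eta zeta,
    smooth_spinor eta p -> smooth_spinor zeta p ->
    dir_deriv p v ((fun x => ((eta x)^T *m zeta x) 0 0) : M -> R^o) =
    ((snab p v eta)^T *m zeta p) 0 0 + ((eta p)^T *m snab p v zeta) 0 0;
  snab_clif : forall p v Y eta, smooth_field Y p -> smooth_spinor eta p ->
    snab p v (fun x => clif S x (Y x) *m eta x) =
    clif S p (D p v Y) *m eta p + clif S p (Y p) *m snab p v eta }.

(* The endomorphism of the spinors by which a k-form at x acts: the image of
   \sum_(a_1 < .. < a_k) w(e_(a_1), .., e_(a_k)) e^(a_1) /\ .. /\ e^(a_k). *)
Definition cl_form {k} (x : M) (w : ('I_k -> 'rV[R]_6) -> R) : 'M[R]_8 :=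
  \sum_(a : {ffun 'I_k -> 'I_6} |
        [forall i : 'I_k, forall j : 'I_k, (i < j)%N ==> (a i < a j)%N])
    w (fun i => row (a i) (onb g x)) *:
    \prod_(i < k) clif S x (row (a i) (onb g x)).

(* The tensor product of a spinor eta and an element xi of a bundle with fibres
   'rV_m is the 8 x m matrix eta *m xi.  For a form w with values in that
   bundle, w . eta is computed on the components of w. *)
Definition cl_act {k m} (x : M) (w : ('I_k -> 'rV[R]_6) -> 'rV[R]_m)
    (eta : 'cV[R]_8) : 'M[R]_(8, m) :=
  \sum_(j < m) cl_form x (fun v => w v 0 j) *m eta *m delta_mx 0 j.

Section Dirac.
Context {D : levi_civita g}.
Variable N : spin_connection D.

(* T is the 3-form denoted by P in the definition of nabla^t. *)
Definition nabla_t (t : R) (T : M -> ('I_3 -> 'rV[R]_6) -> R)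
    (x : M) (v : 'rV[R]_6) (eta : M -> 'cV[R]_8) : 'cV[R]_8 :=
  N x v eta +
  (t / 4) *: (cl_form x (contract v (T x : _ -> R^o)) *m eta x).

Context {m : nat} {G : lie_group R m} {P : principal_bundle M G}.

(* The tensor product connection, by the product rule on
   Xi = \sum_i f_i (x) s_i, where f_i are the columns of the spinor frame around
   x and the s_i are sections of the adjoint bundle. *)
Definition nabla_tA (t : R) (T : M -> ('I_3 -> 'rV[R]_6) -> R)
    (A : principal_connection P)
    (x : M) (v : 'rV[R]_6) (Xi : M -> 'M[R]_(8, m)) : 'M[R]_(8, m) :=
  let f (i : 'I_8) (y : M) : 'cV[R]_8 := col i (sframe S x y) in
  let s (i : 'I_8) (y : M) : 'rV[R]_m := row i (invmx (sframe S x y) *m Xi y) in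
  \sum_(i < 8) (nabla_t t T x v (f i) *m s i x + f i x *m nabla_ad A x v (s i)).

Definition dirac_op (t : R) (T : M -> ('I_3 -> 'rV[R]_6) -> R)
    (A : principal_connection P) (Xi : M -> 'M[R]_(8, m)) (x : M) :
  'M[R]_(8, m) :=
  \sum_(a < 6) clif S x (row a (onb g x)) *m
    nabla_tA t T A x (row a (onb g x)) Xi.

End Dirac.
End Spinors.

Record nearly_kahler (R : realType) := NearlyKahler {
  nk_manifold :> manifold R 6;
  nk_connected : connected [set: nk_manifold];
  nk_metric : oriented_riemannian nk_manifold;
  nk_lc : levi_civita nk_metric;
  nk_spin : spinor_bundle nk_metric;
  nk_snab : spin_connection nk_spin nk_lc;
  nk_psi : nk_manifold -> 'cV[R]_8;
  nk_psi_smooth : forall x, smooth_spinor nk_spin nk_psi x;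
  nk_psi_unit : forall x, (nk_psi x)^T *m nk_psi x = 1%:M;
  nk_killing : forall x (v : 'rV[R]_6),
    nk_snab x v nk_psi = 2^-1 *: (clif nk_spin x v *m nk_psi x) }.

(* 8 psi (x) psi^T = 1 + P - Q determines P and Q, which are thus smooth, since
   Clifford multiplication maps the exterior algebra isomorphically onto the
   endomorphisms of the spinors. *)
Definition nk_forms {R : realType} (X : nearly_kahler R)
    (P : X -> ('I_3 -> 'rV[R]_6) -> R) (Q : X -> ('I_4 -> 'rV[R]_6) -> R) :
  Prop :=
  forall x : X,
  [/\ alternating (P x : _ -> R^o), alternating (Q x : _ -> R^o) &
      8 *: (nk_psi x *m (nk_psi x)^T) =
      1%:M + cl_form (nk_spin X) x (P x) - cl_form (nk_spin X) x (Q x)].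

(* Main.v *)
Require Import Defs.
From HB Require Import structures.
From mathcomp Require Import all_boot all_order all_fingroup all_algebra.
From mathcomp Require Import ring lra.
From mathcomp Require Import all_classical all_reals all_analysis.

Set Implicit Arguments.
Unset Strict Implicit.
Unset Printing Implicit Defensive.

Import Order.TTheory GRing.Theory Num.Theory.
Import numFieldNormedType.Exports.

Local Open Scope classical_set_scope.
Local Open Scope ring_scope.

(* At a point x take the coordinate vector fields of the chart at x that form an
   orthonormal basis e_a at x, and write B for the covariant derivative of
   epsilon, with respect to the Levi-Civita connection and A, in this basis.
   The Levi-Civita connection being torsion free and metric,
     d^A epsilon (e_b, e_c) = B(b, c) - B(c, b)  and
     d^A * epsilon = (sum_b B(b, b)) vol.
   As nabla_v psi = v.psi / 2 and sum_b e_b.e_a.e_b = 4 e_a,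
     D^(t,A) (epsilon.psi) = d^A epsilon.psi - (sum_b B(b, b)) psi
       + 2 epsilon.psi + (3 t / 4) P.epsilon.psi.
   The last term vanishes: conjugating 8 psi psi^T = 1 + P - Q by the Clifford
   volume element omega, which is skew, orthogonal and anticommutes with
   vectors, gives P = 4 (psi psi^T - omega psi (omega psi)^T), and psi and
   omega psi are orthogonal to all v.psi.  The first two terms are orthogonal
   fibrewise, since e_b.e_c is skew for b <> c, so that their difference
   vanishes only if both do. *)

(** * Calculus *)

Section Calculus.
Context {R : realType}.
Implicit Types V W : normedModType R.

(** The bases [onb g y] are chosen point by point without continuity, so a sum over them cannot be
    differentiated as it stands. The sums that have to be differentiated, the Clifford action of
    epsilon and its Hodge dual, depend on the basis only through the tensor [sharp], which has an
    expansion both in [onb g y] and in the coordinate fields [ofield a]; the second one is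
    differentiable. These fields are orthonormal at x alone. The price is their Gram matrix, whose
    first derivatives are Christoffel terms; the gain is that their brackets vanish, in agreement
    with the definition of [dA] by constant components. The volume form suffers from the same
    discontinuity. Its value on the coordinate frame is recovered as the square root of the Gram
    determinant, and [onb_oriented] fixes the sign. The spinor connection is given only by axioms on
    smooth sections, while nabla^(t,A) is defined by one particular spinor frame. Locality and the
    product rule for arbitrary decompositions therefore have to be established before epsilon.psi
    can be differentiated. *)

Lemma near0_differentiable V W (f : V -> W) x :
  (\near x, f x = 0) -> differentiable f x.
Proof.
move=> f0.
have fx0 : f x = 0 by exact: (nbhs_singleton f0).
have h : f \o shift x = cst (f x) + \0 +o_ 0 id.
  apply/eqaddoP => e e0; have : \forall y \near 0, f (y + x) = 0.
    by move: f0; rewrite (near_shift 0) subr0.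
  apply: filterS => y fy.
  rewrite /= !fctE /= fy fx0 addr0 subrr normr0 mulr_ge0 //; exact: ltW.
apply/diff_locallyP; split.
  rewrite (@diff_unique _ _ _ _ \0 _ _ h).
    exact: cst_continuous.
  exact: cst_continuous.
rewrite (@diff_unique _ _ _ _ \0 _ _ h) //; exact: cst_continuous.
Qed.

Lemma near_eq_differentiable V W (f g : V -> W) x :
  (\near x, f x = g x) -> differentiable f x -> differentiable g x.
Proof.
move=> fg df.
have -> : g = f + (g - f) by apply/funext => y; rewrite !fctE subrKC.
apply: differentiableD => //; apply: near0_differentiable.
by apply: filterS fg => y; rewrite !fctE => ->; rewrite subrr.
Qed.

Lemma near_eq_for_continuous (V W : topologicalType) (f g : V -> W) x :
  (\near x, f x = g x) -> {for x, continuous f} -> {for x, continuous g}.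
Proof.
move=> fg; rewrite /prop_for /continuous_at -(nbhs_singleton fg) => fc.
by apply: cvg_trans fc; apply: near_eq_cvg.
Qed.

Lemma derive_comp V W (Z : normedModType R) (f : V -> W) (g : W -> Z) x v :
  differentiable f x -> differentiable g (f x) ->
  'D_v (g \o f) x = 'D_('D_v f x) g (f x).
Proof.
move=> df dg; rewrite [LHS]deriveE; last exact: differentiable_comp.
by rewrite diff_comp // (deriveE _ dg) (deriveE _ df).
Qed.

Lemma derive_dirP V W (f : V -> W) x a v w : differentiable f x ->
  'D_(a *: v + w) f x = a *: 'D_v f x + 'D_w f x.
Proof. by move=> df; rewrite !(deriveE _ df) linearP. Qed.

Section Scale.
Context {V W : normedModType R}.

(** Scaling is presented as a bilinear map on [R^o] and [W], so that the product rule becomes the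
    differential of a continuous bilinear map. *)
Let scal (a : R^o) (w : W) : W := a *: w.

Let scal_bilinear : bilinear_for
  (GRing.Scale.Law.clone _ _ *:%R _) (GRing.Scale.Law.clone _ _ *:%R _) scal.
Proof.
split=> [w a b c|a b w w'] /=.
  by rewrite /scal scalerDl scalerA.
by rewrite /scal scalerDr !scalerA mulrC.
Qed.

HB.instance Definition _ := bilinear_isBilinear.Build R R^o W W _ _ scal
  scal_bilinear.

Let scal_continuous : continuous (fun p : R^o * W => scal p.1 p.2).
Proof. exact: scale_continuous. Qed.

Lemma differentiable_scale (k : V -> R^o) (f : V -> W) x :
  differentiable k x -> differentiable f x ->
  differentiable (fun y => k y *: f y) x.
Proof.
move=> dk df.
apply: (@differentiable_comp _ _ _ _ (fun y => (k y, f y))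
  (fun p : R^o * W => scal p.1 p.2)).
  exact: differentiable_pair.
exact: (@differentiable_bilin _ _ _ _ scal).
Qed.

Lemma derive_scale (k : V -> R^o) (f : V -> W) x v :
  differentiable k x -> differentiable f x ->
  'D_v (fun y => k y *: f y) x = 'D_v k x *: f x + k x *: 'D_v f x.
Proof.
move=> dk df.
rewrite (@derive_comp _ _ _ (fun y => (k y, f y))
  (fun p : R^o * W => scal p.1 p.2)); last 2 first.
- exact: differentiable_pair.
- exact: (@differentiable_bilin _ _ _ _ scal).
rewrite deriveE ; last exact: (@differentiable_bilin _ _ _ _ scal).
rewrite (@diff_bilin _ _ _ _ scal) //= deriveE; last exact: differentiable_pair.
by rewrite diff_pair //= -!deriveE // addrC.
Qed.
End Scale.

(** * Functions of class C^k and smooth germs *)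

Section CkTheory.
Context {V : normedModType R}.

Lemma Ck_subset W k (U U' : set V) (f : V -> W) :
  U' `<=` U -> Ck k U f -> Ck k U' f.
Proof.
move=> UU'; elim: k f => [|k IH] f /= => [fc x /UU'|[df Df]]; first exact: fc.
by split=> [x /UU'|v]; [exact: df|exact: IH].
Qed.

(** On an open set, equal values mean equal germs at each point, hence equal directional
    derivatives, which feeds the induction. *)
Lemma eq_Ck W k (U : set V) (f g : V -> W) :
  open U -> (forall x, U x -> f x = g x) -> Ck k U f -> Ck k U g.
Proof.
move=> oU; elim: k f g => [|k IH] f g fg /=.
  move=> fc x Ux; apply: near_eq_for_continuous (fc x Ux).
  by apply: filterS (open_nbhs_nbhs (conj oU Ux)).
have nfg x : U x -> \near x, f x = g x.
  by move=> Ux; apply: filterS (open_nbhs_nbhs (conj oU Ux)).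
case=> df Df; split=> [x Ux|v].
  exact: near_eq_differentiable (nfg x Ux) (df x Ux).
by apply: IH (Df v) => x Ux; apply: near_eq_derive; exact: nfg.
Qed.

(** Each summand of the product rule keeps one factor undifferentiated; that factor has one order
    more than the induction in [Ck_scale] asks for. *)
Lemma CkW W k (U : set V) (f : V -> W) : Ck k.+1 U f -> Ck k U f.
Proof.
elim: k f => [|k IH] f /= [df Df].
  by move=> x /df; exact: differentiable_continuous.
by split => // v; apply: IH; exact: Df.
Qed.

Lemma Ck_cst W k (U : set V) (a : W) : Ck k U (cst a).
Proof.
elim: k a => [|k IH] a /=; first by move=> x _; exact: cst_continuous.
split=> [x _|v]; first exact: differentiable_cst.
rewrite (_ : (fun _ => _) = cst 0); first exact: IH.
by apply/funext => x; rewrite derive_cst.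
Qed.

Lemma CkD W k (U : set V) (f g : V -> W) : open U ->
  Ck k U f -> Ck k U g -> Ck k U (f \+ g).
Proof.
move=> oU; elim: k f g => [|k IH] f g /=.
  by move=> cf cg x Ux; apply: continuousD; [exact: cf|exact: cg].
case=> df Df [dg Dg]; split=> [x Ux|v].
  by apply: differentiableD; [exact: df|exact: dg].
apply: eq_Ck (IH _ _ (Df v) (Dg v)) => // x Ux /=.
by rewrite deriveD //; apply: diff_derivable; [exact: df|exact: dg].
Qed.

Lemma Ck_scale W k (U : set V) (a : V -> R^o) (f : V -> W) : open U ->
  Ck k U a -> Ck k U f -> Ck k U (fun x => a x *: f x).
Proof.
move=> oU; elim: k a f => [|k IH] a f.
  by move=> ca cf x Ux; apply: continuousZ; [exact: ca|exact: cf].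
move=> Ca Cf; have [da Da] := Ca; have [df Df] := Cf; split=> [x Ux|v].
  by apply: differentiable_scale; [exact: da|exact: df].
have := CkD oU (IH _ _ (Da v) (CkW Cf)) (IH _ _ (CkW Ca) (Df v)).
apply: eq_Ck => // x Ux /=.
by rewrite derive_scale //; [exact: da|exact: df].
Qed.

Lemma Ck_linear W (Z : normedModType R) k (U : set V) (L : {linear W -> Z})
    (f : V -> W) : open U -> continuous L ->
  Ck k U f -> Ck k U (L \o f).
Proof.
move=> oU cL; elim: k f => [|k IH] f /=.
  by move=> cf x Ux; apply: continuous_comp; [exact: cf|exact: cL].
case=> df Df; split=> [x Ux|v].
  apply: differentiable_comp; [exact: df|exact: linear_differentiable].
apply: eq_Ck (IH _ (Df v)) => // x Ux /=.
rewrite derive_comp; [|exact: df|exact: linear_differentiable].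
by rewrite [RHS]deriveE; [rewrite diff_lin|exact: linear_differentiable].
Qed.

Lemma smooth_near_differentiable W (f : V -> W) x :
  smooth_near f x -> differentiable f x.
Proof. by case=> U [oU Ux] /(_ 1%N) [df _]; exact: df. Qed.

Lemma near_eq_smooth_near W (f g : V -> W) x :
  (\near x, f x = g x) -> smooth_near f x -> smooth_near g x.
Proof.
move=> fg; have : nbhs x (fun y => f y = g y) := fg.
rewrite nbhsE => -[U' [oU' U'x] {}fg] [U [oU Ux] Cf].
exists (U `&` U'); first by split; [exact: openI|split].
move=> k; apply: eq_Ck (Ck_subset _ (Cf k)).
- exact: openI.
- by move=> y [_ /fg].
- by move=> y [].
Qed.

Lemma smooth_near_cst W (a : W) x : smooth_near (cst a : V -> W) x.
Proof.
exists setT; first by split => //; exact: openT.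
by move=> k; exact: Ck_cst.
Qed.

Lemma smooth_nearD W (f g : V -> W) x :
  smooth_near f x -> smooth_near g x -> smooth_near (f \+ g) x.
Proof.
move=> [U [oU Ux] Cf] [U' [oU' U'x] Cg].
exists (U `&` U'); first by split; [exact: openI|split].
move=> k; apply: CkD; first exact: openI.
  by apply: Ck_subset (Cf k) => y [].
by apply: Ck_subset (Cg k) => y [].
Qed.

Lemma smooth_near_scale W (a : V -> R^o) (f : V -> W) x :
  smooth_near a x -> smooth_near f x -> smooth_near (fun y => a y *: f y) x.
Proof.
move=> [U [oU Ux] Cf] [U' [oU' U'x] Cg].
exists (U `&` U'); first by split; [exact: openI|split].
move=> k; apply: Ck_scale; first exact: openI.
  by apply: Ck_subset (Cf k) => y [].
by apply: Ck_subset (Cg k) => y [].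
Qed.

Lemma smooth_near_linear W (Z : normedModType R) (L : {linear W -> Z})
    (f : V -> W) x : continuous L ->
  smooth_near f x -> smooth_near (L \o f) x.
Proof.
move=> cL [U [oU Ux] Cf]; exists U => // k; exact: Ck_linear.
Qed.

End CkTheory.
End Calculus.

(** * Manifolds *)

Section ManifoldCalculus.
Context {R : realType}.

Section OneManifold.
Context {n : nat} {M : manifold R n}.
Implicit Types (p c x : M).

Lemma near_cdom c x : cdom (chart_at c) x -> \near x, cdom (chart_at c) x.
Proof.
by move=> cx; apply: open_nbhs_nbhs; split => //; exact: cdom_open.
Qed.

Lemma near_in_chart c x (Q : M -> Prop) : cdom (chart_at c) x ->
  (\near x, Q x) -> \forall u \near chart_at c x, Q (point_of (chart_at c) u).
Proof.
move=> cx Qx.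
have /= := @point_of_continuous _ _ _ (chart_at c) (chart_at c x).
move=> /(_ (ex_intro2 _ _ x cx erefl)).
by rewrite /prop_for /continuous_at (chart_mapK cx) => /(_ _ Qx).
Qed.

(** The final identities involve only first derivatives at one point. Differentiability there is
    enough for them, and it passes easily to determinants, inverse matrices and square roots. *)
Definition diff_at {W : normedModType R} (f : M -> W) (p : M) : Prop :=
  differentiable (in_chart p f) (chart_at p p).

Lemma smooth_diff_at (W : normedModType R) (f : M -> W) p :
  smooth_at f p -> diff_at f p.
Proof. exact: smooth_near_differentiable. Qed.

Section Local.
Context {W : normedModType R}.
Implicit Types f g : M -> W.

Lemma near_eq_smooth_at f g p :
  (\near p, f p = g p) -> smooth_at f p -> smooth_at g p.
Proof.
move=> fg; apply: near_eq_smooth_near.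
exact: (near_in_chart (chart_at_dom p) fg).
Qed.

Lemma near_eq_diff_at f g p :
  (\near p, f p = g p) -> diff_at f p -> diff_at g p.
Proof.
move=> fg; apply: near_eq_differentiable.
exact: (near_in_chart (chart_at_dom p) fg).
Qed.

Lemma near_eq_dir_deriv f g p v :
  (\near p, f p = g p) -> dir_deriv p v f = dir_deriv p v g.
Proof.
move=> fg; apply: near_eq_derive.
exact: (near_in_chart (chart_at_dom p) fg).
Qed.

Lemma smooth_at_cst (a : W) p : smooth_at (fun=> a : W) p.
Proof. exact: smooth_near_cst. Qed.

Lemma smooth_atD f g p :
  smooth_at f p -> smooth_at g p -> smooth_at (fun x => f x + g x) p.
Proof. exact: smooth_nearD. Qed.

Lemma smooth_at_scale (a : M -> R^o) f p :
  smooth_at a p -> smooth_at f p -> smooth_at (fun x => a x *: f x) p.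
Proof. exact: smooth_near_scale. Qed.

Lemma smooth_at_linear (Z : normedModType R) (L : {linear W -> Z}) f p :
  continuous L -> smooth_at f p -> smooth_at (fun x => L (f x)) p.
Proof. exact: smooth_near_linear. Qed.

Lemma dir_deriv_cst (a : W) p v : dir_deriv p v (fun=> a : W) = 0.
Proof. exact: derive_cst. Qed.

Lemma diff_at_cst (a : W) p : diff_at (fun=> a : W) p.
Proof. exact: differentiable_cst. Qed.

Lemma diff_atD f g p :
  diff_at f p -> diff_at g p -> diff_at (fun x => f x + g x) p.
Proof. exact: differentiableD. Qed.

Lemma dir_derivD f g p v : diff_at f p -> diff_at g p ->
  dir_deriv p v (fun x => f x + g x) = dir_deriv p v f + dir_deriv p v g.
Proof.
by move=> df dg; rewrite /dir_deriv -deriveD //; exact: diff_derivable.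
Qed.

Lemma diff_at_scale (a : M -> R^o) f p :
  diff_at a p -> diff_at f p -> diff_at (fun x => a x *: f x) p.
Proof. exact: differentiable_scale. Qed.

Lemma dir_deriv_scale (a : M -> R^o) f p v : diff_at a p -> diff_at f p ->
  dir_deriv p v (fun x => a x *: f x) =
  dir_deriv p v a *: f p + a p *: dir_deriv p v f.
Proof.
move=> da df; rewrite /dir_deriv (derive_scale _ da df) /in_chart.
by rewrite (chart_mapK (chart_at_dom p)).
Qed.

Lemma diff_at_linear (Z : normedModType R) (L : {linear W -> Z}) f p :
  continuous L -> diff_at f p -> diff_at (fun x => L (f x)) p.
Proof.
by move=> cL df; apply: differentiable_comp df _; exact: linear_differentiable.
Qed.

Lemma dir_derivP f p a v w : diff_at f p ->
  dir_deriv p (a *: v + w) f = a *: dir_deriv p v f + dir_deriv p w f.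
Proof. exact: derive_dirP. Qed.

Lemma diff_at_sum (I : Type) (r : seq I) (f : I -> M -> W) p :
  (forall i, diff_at (f i) p) -> diff_at (fun x => \sum_(i <- r) f i x) p.
Proof.
move=> df; elim: r => [|i r IH].
  by under eq_fun do rewrite big_nil; exact: diff_at_cst.
by under eq_fun do rewrite big_cons; exact: diff_atD.
Qed.

Lemma dir_deriv_sum (I : Type) (r : seq I) (f : I -> M -> W) p v :
  (forall i, diff_at (f i) p) ->
  dir_deriv p v (fun x => \sum_(i <- r) f i x) =
  \sum_(i <- r) dir_deriv p v (f i).
Proof.
move=> df; elim: r => [|i r IH].
  by under eq_fun do rewrite big_nil; rewrite big_nil dir_deriv_cst.
under eq_fun do rewrite big_cons.
by rewrite big_cons -IH dir_derivD //; exact: diff_at_sum.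
Qed.

End Local.

Section Scalars.
Implicit Types f g : M -> R^o.

Lemma diff_atM f g p : diff_at f p -> diff_at g p ->
  diff_at (fun x => f x * g x : R^o) p.
Proof. exact: diff_at_scale. Qed.

Lemma dir_derivM f g p v : diff_at f p -> diff_at g p ->
  dir_deriv p v (fun x => f x * g x : R^o) =
  dir_deriv p v f * g p + f p * dir_deriv p v g.
Proof. exact: dir_deriv_scale. Qed.

Lemma diff_at_prod (I : Type) (r : seq I) (f : I -> M -> R^o) p :
  (forall i, diff_at (f i) p) -> diff_at (fun x => \prod_(i <- r) f i x : R^o) p.
Proof.
move=> df; elim: r => [|i r IH].
  by under eq_fun do rewrite big_nil; exact: diff_at_cst.
by under eq_fun do rewrite big_cons; exact: diff_atM.
Qed.

Lemma diff_at_comp (h : R^o -> R^o) f p :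
  differentiable h (f p) -> diff_at f p -> diff_at (fun x => h (f x)) p.
Proof.
move=> dh df; apply: (differentiable_comp df).
by rewrite /in_chart (chart_mapK (chart_at_dom p)).
Qed.

Lemma diff_at_det k (A : M -> 'M[R]_k) p :
  (forall i j, diff_at (fun x => A x i j : R^o) p) ->
  diff_at (fun x => \det (A x) : R^o) p.
Proof.
move=> dA; rewrite /determinant; apply: diff_at_sum => s.
by apply: diff_atM; [exact: diff_at_cst|exact: diff_at_prod].
Qed.

Lemma diff_at_adj k (A : M -> 'M[R]_k) p :
  (forall i j, diff_at (fun x => A x i j : R^o) p) ->
  forall i j, diff_at (fun x => (\adj (A x)) i j : R^o) p.
Proof.
move=> dA i j; under eq_fun do rewrite mxE.
rewrite /cofactor; apply: diff_atM; first exact: diff_at_cst.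
apply: diff_at_det => i' j'; under eq_fun do rewrite !mxE; exact: dA.
Qed.

(** Cramer's formula describes [invmx] only at invertible matrices, so invertibility is required in
    a neighbourhood. *)
Lemma diff_at_invmx k (A : M -> 'M[R]_k) p :
  (forall i j, diff_at (fun x => A x i j : R^o) p) ->
  A p \in unitmx -> (\near p, A p \in unitmx) ->
  forall i j, diff_at (fun x => (invmx (A x)) i j : R^o) p.
Proof.
move=> dA Ap nA i j.
apply: (@near_eq_diff_at _ (fun x => (\det (A x))^-1 * (\adj (A x)) i j)).
  by apply: filterS nA => x Ax; rewrite /invmx Ax [RHS]mxE.
apply: (@diff_atM (fun x => (\det (A x))^-1) (fun x => (\adj (A x)) i j)); last exact: diff_at_adj.
apply: (@diff_at_comp (fun y : R^o => y^-1 : R^o) (fun x => \det (A x))); last exact: diff_at_det.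
by apply: differentiable_Rinv; rewrite -unitfE -unitmxE.
Qed.


Lemma dir_deriv_prod (I : eqType) (r : seq I) (f : I -> M -> R^o) p v :
  uniq r -> (forall i, diff_at (f i) p) ->
  dir_deriv p v (fun x => \prod_(i <- r) f i x : R^o) =
  \sum_(i <- r) dir_deriv p v (f i) * \prod_(j <- r | j != i) f j p.
Proof.
move=> ur df; elim: r ur => [_|i r IH /= /andP[ir ur]].
  by under eq_fun do rewrite big_nil; rewrite big_nil dir_deriv_cst.
under eq_fun do rewrite big_cons.
rewrite dir_derivM //; last exact: diff_at_prod.
rewrite big_cons (IH ur) big_cons eqxx /=; congr (_ * _ + _).
  rewrite big_seq [RHS]big_seq_cond; apply: eq_bigl => j.
  by case: (boolP (j \in r)) => //= jr; apply/esym; apply: contraNneq ir => <-.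
rewrite mulr_sumr; apply: eq_big_seq => j jr; rewrite big_cons.
have -> : i != j by apply: contraNneq ir => ->.
by rewrite mulrCA.
Qed.

(** Jacobi's formula at the identity matrix: a permutation other than 1 moves at least two indices,
    so whichever factor is differentiated, another factor is an off-diagonal entry of the
    identity. *)
Lemma dir_deriv_det1 k (A : M -> 'M[R]_k) p v :
  (forall i j, diff_at (fun x => A x i j : R^o) p) -> A p = 1%:M ->
  dir_deriv p v (fun x => \det (A x) : R^o) =
  \sum_(i < k) dir_deriv p v (fun x => A x i i : R^o).
Proof.
move=> dA A1; rewrite /determinant dir_deriv_sum; last first.
  by move=> s; apply: diff_atM; [exact: diff_at_cst|exact: diff_at_prod].
have dprod (s : {perm 'I_k}) : dir_deriv p v (fun x => (-1) ^+ s * \prod_(i < k) A x i (s i) : R^o)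
   = (-1) ^+ s * \sum_(i < k) dir_deriv p v (fun x => A x i (s i) : R^o) *
       \prod_(j < k | j != i) A p j (s j).
  rewrite (@dir_derivM (fun=> (-1) ^+ s) (fun x => \prod_(i < k) A x i (s i)));
    [|exact: diff_at_cst|exact: diff_at_prod].
  rewrite dir_deriv_cst mul0r add0r; congr (_ * _).
  by rewrite (@dir_deriv_prod _ _ (fun i x => A x i (s i))) // index_enum_uniq.
under eq_bigr do rewrite dprod.
rewrite (bigD1 1%g) //= [X in _ + X]big1 ?addr0 => [|s s1].
  rewrite odd_perm1 expr0 mul1r; apply: eq_bigr => i _.
  rewrite big1 ?mulr1 => [|j _]; first by under eq_fun do rewrite perm1.
  by rewrite perm1 A1 mxE eqxx.
rewrite big1 ?mulr0 // => i _.
(* If the moved index found first is i itself, then s i is also moved, by injectivity of s, and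
   differs from i. *)
have [j ji sj] : exists2 j, j != i & s j != j.
  have [j sj] : exists j, s j != j.
    apply/existsP; apply: contraNT s1 => /existsPn h; apply/eqP/permP => j.
    by rewrite perm1; apply/eqP; move: (h j); rewrite negbK.
  have [ji|ji] := eqVneq j i; last by exists j.
  exists (s j); first by rewrite -ji.
  by apply: contra_neq sj => /perm_inj.
by rewrite (bigD1 j) //= A1 mxE eq_sym (negbTE sj) mul0r mulr0.
Qed.

End Scalars.

(** The vector field with constant components [v] in the chart at [c]: [tframe] converts them to the
    identification of the tangent space at [x] given by the chart at [x]. *)
Definition coord_field (c : M) (v : 'rV[R]_n) (x : M) : 'rV[R]_n :=
  v *m tframe c x.

Lemma transition_differentiable (a b x : M) :
  cdom (chart_at a) x -> cdom (chart_at b) x ->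
  differentiable (in_chart a (chart_at b)) (chart_at a x).
Proof.
by move=> ax bx; exact: smooth_near_differentiable (transition_smooth ax bx).
Qed.

Lemma mul_tframe c x (v : 'rV[R]_n) : cdom (chart_at c) x ->
  v *m tframe c x = 'D_v (in_chart c (chart_at x)) (chart_at c x).
Proof.
move=> cx; have dt := transition_differentiable cx (chart_at_dom x).
rewrite deriveE // {2}(row_sum_delta v) linear_sum mulmx_sum_row /=.
by apply: eq_bigr => i _; rewrite linearZ /= rowK deriveE.
Qed.

(** The two transition maps compose to the identity near the point, so by the chain rule a vector
    killed by the first differential is zero. *)
Lemma tframe_unit c x : cdom (chart_at c) x -> tframe c x \in unitmx.
Proof.
move=> cx; rewrite -row_free_unit; apply: inj_row_free => v v0.
have dt := transition_differentiable cx (chart_at_dom x).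
have dt' := transition_differentiable (chart_at_dom x) cx.
have e : point_of (chart_at c) (chart_at c x) = x by exact: chart_mapK.
have dt'' : differentiable (in_chart x (chart_at c))
    (in_chart c (chart_at x) (chart_at c x)).
  by rewrite /in_chart e.
have := @derive_comp _ _ _ _ _ _ _ v dt dt''.
rewrite -(mul_tframe _ cx) v0 derive0.
rewrite (@near_eq_derive _ _ _ _ id) ?derive_id //.
have near_dom : \forall y \near x, cdom (chart_at c) y /\ cdom (chart_at x) y.
  by apply: filterI; apply: near_cdom => //; exact: chart_at_dom.
have := near_in_chart cx near_dom.
have : \forall u \near chart_at c x, (chart_at c @` cdom (chart_at c)) u.
  apply: open_nbhs_nbhs; split; first exact: cimage_open.
  by exists x.
apply: filterS2 => u [y cy <-]; rewrite /in_chart /= (chart_mapK cy) => -[_ xy].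
by rewrite (chart_mapK xy).
Qed.

Lemma tframe_id x : tframe x x = 1%:M.
Proof.
apply/row_matrixP => i; rewrite rowK row1.
rewrite (@near_eq_derive _ _ _ _ id) ?derive_id //.
have : \forall u \near chart_at x x, (chart_at x @` cdom (chart_at x)) u.
  apply: open_nbhs_nbhs; split; first exact: cimage_open.
  by exists x => //; exact: chart_at_dom.
by apply: filterS => u [y cy <-]; rewrite /in_chart (chart_mapK cy).
Qed.

Lemma components_coord_field p v :
  \forall x \near p, components (coord_field p v) p x = v.
Proof.
apply: filterS (near_cdom (chart_at_dom p)) => x px.
by rewrite /components /coord_field mulmxK // tframe_unit.
Qed.

Lemma smooth_coord_field p v : smooth_field (coord_field p v) p.
Proof.
apply: near_eq_smooth_at (smooth_at_cst v p).
by apply: filterS (components_coord_field p v) => x ->.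
Qed.

Lemma lie_bracket_coord_field p v w :
  lie_bracket (coord_field p v) (coord_field p w) p = 0.
Proof.
have h u : dir_deriv p u (components (coord_field p w) p) = 0.
  by rewrite (near_eq_dir_deriv u (components_coord_field p w)) dir_deriv_cst.
have h' u : dir_deriv p u (components (coord_field p v) p) = 0.
  by rewrite (near_eq_dir_deriv u (components_coord_field p v)) dir_deriv_cst.
by rewrite /lie_bracket h h' subr0.
Qed.

End OneManifold.

(** * Differentiable maps between manifolds and the chain rule *)

Section Maps.

Definition diff_map_at {m n} {M : manifold R m} {N : manifold R n}
    (F : M -> N) (p : M) : Prop :=
  {for p, continuous F} /\ diff_at (fun x => chart_at (F p) (F x)) p.

Lemma smooth_diff_map_at {m n} {M : manifold R m} {N : manifold R n}
    (F : M -> N) (p : M) : smooth_map_at F p -> diff_map_at F p.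
Proof. by case=> cF sF; split => //; exact: smooth_diff_at. Qed.

Lemma near_comp {S T : topologicalType} (F : S -> T) (p : S) (Q : T -> Prop) :
  {for p, continuous F} -> (\forall y \near F p, Q y) -> \near p, Q (F p).
Proof. by move=> cF QF; exact: cF. Qed.

Section Comp.
Context {m n} {M : manifold R m} {N : manifold R n}.
Variables (F : M -> N) (p : M).
Hypothesis dF : diff_map_at F p.

(** The two sides agree only as germs: inserting the chart at [F p] and its inverse is harmless
    while F stays in the domain of that chart, which continuity ensures near p. *)
Let in_chart_comp (W : Type) (f : N -> W) :
  \forall u \near chart_at p p,
    in_chart p (fun x => f (F x)) u =
    (in_chart (F p) f \o in_chart p (fun x => chart_at (F p) (F x))) u.
Proof.
have [cF _] := dF.
have := near_comp cF (near_cdom (chart_at_dom (F p))).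
move=> /(near_in_chart (chart_at_dom p)); apply: filterS => u Fu.
by rewrite /in_chart /= (chart_mapK Fu).
Qed.

Let base : in_chart p (fun x => chart_at (F p) (F x)) (chart_at p p) =
  chart_at (F p) (F p).
Proof. by rewrite /in_chart (chart_mapK (chart_at_dom p)). Qed.

Lemma diff_at_map (W : normedModType R) (f : N -> W) :
  diff_at f (F p) -> diff_at (fun x => f (F x)) p.
Proof.
move=> df; apply: (@near_eq_differentiable _ _ _ (in_chart (F p) f \o
  in_chart p (fun x => chart_at (F p) (F x)))).
  by apply: filterS (in_chart_comp f) => u ->.
by apply: differentiable_comp; [exact: dF.2|rewrite base].
Qed.

Lemma dir_deriv_map (W : normedModType R) (f : N -> W) v :
  diff_at f (F p) ->
  dir_deriv p v (fun x => f (F x)) = dir_deriv (F p) (tmap F p v) f.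
Proof.
move=> df; rewrite /dir_deriv (near_eq_derive v (in_chart_comp f)).
by rewrite derive_comp ?base //; exact: dF.2.
Qed.

End Comp.

Lemma diff_map_at_comp {m n k} {M : manifold R m} {N : manifold R n}
    {Q : manifold R k} (F : M -> N) (H : N -> Q) (p : M) :
  diff_map_at F p -> diff_map_at H (F p) -> diff_map_at (H \o F) p.
Proof.
move=> dF [cH dH]; split; first exact: continuous_comp dF.1 cH.
exact: (@diff_at_map _ _ _ _ _ _ dF _ (fun y => chart_at (H (F p)) (H y))).
Qed.

End Maps.

End ManifoldCalculus.

(** * Adjoint bundles *)

Section LieGroups.
Context {R : realType} {m : nat} {G : lie_group R m}.
Implicit Types a b : G.

(** The group axioms give only a left unit and left inverses; multiplying [a b] on the left by
    [linv b] times [b] turns a left inverse into a right one. *)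
Lemma lmulrV a : lmul a (linv a) = lone G.
Proof.
set b := linv a.
have e : lmul (lmul (linv b) b) (lmul a b) = lone G.
  by rewrite -lmulA (lmulA b a b) /b lmulV lmul1 lmulV.
by rewrite lmulV lmul1 in e.
Qed.

Lemma lmulr1 a : lmul a (lone G) = a.
Proof. by rewrite -(lmulV a) lmulA lmulrV lmul1. Qed.

Lemma linv1 : linv (lone G) = lone G.
Proof. by rewrite -[LHS]lmulr1 lmulV. Qed.

(** Left translation is the jointly smooth multiplication restricted to a slice, whose inclusion is
    affine in the charts. *)
Lemma lmull_diff_map a b : diff_map_at (lmul a) b.
Proof.
have [cm sm] := lmul_smooth a b; split.
  move: cm; rewrite /prop_for /continuous_at /= => cm.
  apply: (@continuous_comp _ _ _ (fun y => (a, y))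
            (fun z : G * G => lmul z.1 z.2)); last exact: cm.
  by apply: cvg_pair; [exact: cvg_cst|exact: cvg_id].
have dm := smooth_near_differentiable sm.
rewrite /diff_at (_ : in_chart _ _ = (fun z : 'rV[R]_m * 'rV[R]_m =>
      chart_at (lmul a b) (lmul (point_of (chart_at a) z.1)
        (point_of (chart_at b) z.2))) \o (fun u => (chart_at a a : 'rV[R]_m, u))); last first.
  by apply/funext => u; rewrite /in_chart /= (chart_mapK (chart_at_dom a)).
apply: differentiable_comp; last exact: dm.
by apply: differentiable_pair; [exact: differentiable_cst|exact: ex_diff].
Qed.

Lemma lmulr_diff_map a b : diff_map_at (fun c => lmul c b) a.
Proof.
have [cm sm] := lmul_smooth a b; split.
  move: cm; rewrite /prop_for /continuous_at /= => cm.
  apply: (@continuous_comp _ _ _ (fun y => (y, b))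
            (fun z : G * G => lmul z.1 z.2)); last exact: cm.
  by apply: cvg_pair; [exact: cvg_id|exact: cvg_cst].
have dm := smooth_near_differentiable sm.
rewrite /diff_at (_ : in_chart _ _ = (fun z : 'rV[R]_m * 'rV[R]_m =>
      chart_at (lmul a b) (lmul (point_of (chart_at a) z.1)
        (point_of (chart_at b) z.2))) \o (fun u => (u, chart_at b b : 'rV[R]_m))); last first.
  by apply/funext => u; rewrite /in_chart /= (chart_mapK (chart_at_dom b)).
apply: differentiable_comp; last exact: dm.
by apply: differentiable_pair; [exact: ex_diff|exact: differentiable_cst].
Qed.

(** Conjugation is a left translation followed by a right translation, hence differentiable at the
    identity, and [Ad a] is its differential there. *)
Lemma Ad_linear a : linear (@Ad R m G a).
Proof.
move=> k v w; apply: dir_derivP.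
have := diff_map_at_comp (lmull_diff_map a (lone G))
  (lmulr_diff_map (lmul a (lone G)) (linv a)).
by case.
Qed.

Lemma Ad1 (v : 'rV[R]_m) : Ad (lone G) v = v.
Proof.
rewrite /Ad /tmap /dir_deriv lmul1 linv1 lmulr1.
rewrite (@near_eq_derive _ _ _ _ id) ?derive_id //.
have : \forall u \near chart_at (lone G) (lone G),
    (chart_at (lone G) @` cdom (chart_at (lone G))) u.
  apply: open_nbhs_nbhs; split; first exact: cimage_open.
  by exists (lone G) => //; exact: chart_at_dom.
apply: filterS => u [y cy <-].
by rewrite /in_chart (chart_mapK cy) lmul1 lmulr1.
Qed.

End LieGroups.

(** * The covariant derivative on the adjoint bundle *)

Section NablaAd.
Context {R : realType} {n m : nat} {M : manifold R n} {G : lie_group R m}.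
Context {P : principal_bundle M G} (A : principal_connection P).
Implicit Types (x : M) (s : M -> 'rV[R]_m).

Lemma tdom_id x : tdom P x x.
Proof. by have [] := tdom_nbhs P x. Qed.

Lemma bproj_tsec x : bproj (tsec P x x) = x.
Proof. exact: tsecK (tdom_id x). Qed.

(** The point [tsec P x x] has group coordinate 1 in its own trivialization, so the equivariant
    function takes there the value that represents the section. *)
Lemma ad_fun_tsec s x : ad_fun (P:=P) s (tsec P x x) = s x.
Proof.
rewrite /ad_fun bproj_tsec.
have := ract_tsecK (lone G) (tdom_id x); rewrite ract1 => ->.
by rewrite linv1 Ad1.
Qed.

Lemma near_bproj x (Q : M -> Prop) :
  (\near x, Q x) -> \forall q \near tsec P x x, Q (bproj q).
Proof.
move=> Qx; have [cb _] := bproj_smooth (tsec P x x).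
by apply: near_comp cb _; rewrite bproj_tsec.
Qed.

Definition diff_ad s x : Prop := diff_at (ad_fun (P:=P) s) (tsec P x x).

Lemma smooth_diff_ad s x : smooth_ad P s x -> diff_ad s x.
Proof. exact: smooth_diff_at. Qed.

Lemma near_eq_nabla_ad s s' x v :
  (\near x, s x = s' x) -> nabla_ad A x v s = nabla_ad A x v s'.
Proof.
move=> ss; apply: near_eq_dir_deriv.
by apply: filterS (near_bproj ss) => q e; rewrite /ad_fun e.
Qed.

Let ad_funD s s' :
  ad_fun (P:=P) (fun y => s y + s' y) = fun q => ad_fun (P:=P) s q + ad_fun (P:=P) s' q.
Proof.
apply/funext => q; rewrite /ad_fun.
by rewrite -[s _]scale1r Ad_linear !scale1r.
Qed.

Let ad_funZ (f : M -> R^o) s :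
  ad_fun (P:=P) (fun y => f y *: s y) = fun q => f (bproj q) *: ad_fun (P:=P) s q.
Proof.
apply/funext => q; rewrite /ad_fun.
have Ad0 a : @Ad R m G a 0 = 0.
  have := @Ad_linear _ _ G a (-1) 0 0.
  by rewrite scaler0 addr0 scaleN1r addNr.
by rewrite -[f _ *: s _]addr0 Ad_linear Ad0 addr0.
Qed.

Lemma diff_adD s s' x :
  diff_ad s x -> diff_ad s' x -> diff_ad (fun y => s y + s' y) x.
Proof. by rewrite /diff_ad ad_funD; exact: diff_atD. Qed.

Lemma nabla_adD s s' x v : diff_ad s x -> diff_ad s' x ->
  nabla_ad A x v (fun y => s y + s' y) =
  nabla_ad A x v s + nabla_ad A x v s'.
Proof. by move=> ds ds'; rewrite /nabla_ad ad_funD; exact: dir_derivD. Qed.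

Let diff_bproj (f : M -> R^o) x : diff_at f x ->
  diff_at (fun q => f (bproj q) : R^o) (tsec P x x).
Proof.
move=> df; apply: diff_at_map; last by rewrite bproj_tsec.
exact/smooth_diff_map_at/bproj_smooth.
Qed.

Lemma diff_ad_scale (f : M -> R^o) s x :
  diff_at f x -> diff_ad s x -> diff_ad (fun y => f y *: s y) x.
Proof.
by move=> df ds; rewrite /diff_ad ad_funZ; apply: diff_at_scale => //; exact: diff_bproj.
Qed.

(** Upstairs f becomes its pullback along [bproj]; since the horizontal lift of v projects to v, the
    derivative of the pullback is that of f along v. *)
Lemma nabla_ad_scale (f : M -> R^o) s x v : diff_at f x -> diff_ad s x ->
  nabla_ad A x v (fun y => f y *: s y) =
  dir_deriv x v f *: s x + f x *: nabla_ad A x v s.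
Proof.
move=> df ds; rewrite /nabla_ad ad_funZ.
apply: etrans (dir_deriv_scale _ (diff_bproj df) ds) _.
have dbx : dir_deriv (tsec P x x) (hlift A (tsec P x x) v)
    (fun q => f (bproj q) : R^o) = dir_deriv x v f.
  rewrite dir_deriv_map; last by rewrite bproj_tsec.
    by rewrite hlift_bproj bproj_tsec.
  exact/smooth_diff_map_at/bproj_smooth.
have fx : f (bproj (tsec P x x)) = f x by rewrite bproj_tsec.
by rewrite dbx fx (ad_fun_tsec s x).
Qed.

Lemma nabla_ad_dirP s x a v w : diff_ad s x ->
  nabla_ad A x (a *: v + w) s = a *: nabla_ad A x v s + nabla_ad A x w s.
Proof. by move=> ds; rewrite /nabla_ad linearP dir_derivP. Qed.

Lemma diff_ad0 x : diff_ad (fun=> 0) x.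
Proof.
rewrite /diff_ad; have -> : ad_fun (P:=P) (fun=> 0) = fun=> 0.
  have := ad_funZ (fun=> 0) (fun=> 0).
  under eq_fun do rewrite scaler0; move=> ->.
  by under eq_fun do rewrite scale0r.
exact: diff_at_cst.
Qed.

Lemma nabla_ad0 x v : nabla_ad A x v (fun=> 0) = 0.
Proof.
have := @nabla_ad_scale (fun=> 0) (fun=> 0) x v (diff_at_cst _ _) (diff_ad0 x).
by under eq_fun do rewrite scaler0; rewrite dir_deriv_cst !scale0r addr0.
Qed.

Lemma diff_ad_sum (I : Type) (r : seq I) (s : I -> M -> 'rV[R]_m) x :
  (forall i, diff_ad (s i) x) -> diff_ad (fun y => \sum_(i <- r) s i y) x.
Proof.
move=> ds; elim: r => [|i r IH].
  by under eq_fun do rewrite big_nil; exact: diff_ad0.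
by under eq_fun do rewrite big_cons; exact: diff_adD.
Qed.

Lemma nabla_ad_sum (I : Type) (r : seq I) (s : I -> M -> 'rV[R]_m) x v :
  (forall i, diff_ad (s i) x) ->
  nabla_ad A x v (fun y => \sum_(i <- r) s i y) =
  \sum_(i <- r) nabla_ad A x v (s i).
Proof.
move=> ds; elim: r => [|i r IH].
  by under eq_fun do rewrite big_nil; rewrite big_nil nabla_ad0.
under eq_fun do rewrite big_cons.
by rewrite big_cons -IH nabla_adD //; exact: diff_ad_sum.
Qed.

Lemma nabla_ad_dir_sum s x (I : Type) (r : seq I) (a : I -> R)
    (v : I -> 'rV[R]_n) : diff_ad s x ->
  nabla_ad A x (\sum_(i <- r) a i *: v i) s =
  \sum_(i <- r) a i *: nabla_ad A x (v i) s.
Proof.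
move=> ds; elim: r => [|i r IH].
  have := nabla_ad_dirP (-1) 0 0 ds.
  by rewrite !big_nil scaler0 addr0 scaleN1r addNr.
by rewrite !big_cons nabla_ad_dirP // IH.
Qed.

End NablaAd.

(** * Spinor connections *)

Section Coordinates.
Context {R : realType} {k l : nat}.
Variables (i : 'I_k) (j : 'I_l).

Definition mx_coord (A : 'M[R]_(k, l)) : R^o := A i j.

Lemma mx_coord_is_linear : linear mx_coord.
Proof. by move=> a A B; rewrite /mx_coord !mxE. Qed.

HB.instance Definition _ := GRing.isLinear.Build R 'M[R]_(k, l) R^o _
  mx_coord mx_coord_is_linear.

Lemma mx_coord_continuous : continuous mx_coord.
Proof. exact: coord_continuous. Qed.

End Coordinates.

Section LinearConnection.
Context {R : realType} {n : nat} {M : manifold R n} {W : normedModType R}.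
Context {sm : (M -> W) -> M -> Prop} {nab : M -> 'rV[R]_n -> (M -> W) -> W}.
Hypothesis nabP : linear_connection sm nab.

(* The indicator function of the set where the two sections agree is smooth
   near p, so the product rule replaces a bump function. *)
Lemma conn_local p v s s' : sm s p -> sm s' p -> (\near p, s p = s' p) ->
  nab p v s = nab p v s'.
Proof.
move=> ss ss' e.
pose f : M -> R^o := fun y => if s y == s' y then 1 else 0.
have f1 : \near p, (1 : R^o) = f p.
  by apply: filterS e => y; rewrite /f => ->; rewrite eqxx.
have sf : smooth_at f p := near_eq_smooth_at f1 (smooth_at_cst _ p).
have df : dir_deriv p v f = 0 by rewrite -(near_eq_dir_deriv v f1) dir_deriv_cst.
have fp : f p = 1 by rewrite -(nbhs_singleton f1).
have fs : (fun y => f y *: s y) = (fun y => f y *: s' y).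
  by apply/funext => y; rewrite /f; case: eqP => [->//|_]; rewrite !scale0r.
have := conn_leibniz nabP v sf ss; rewrite fs (conn_leibniz nabP v sf ss').
by rewrite df fp !scale0r !add0r !scale1r.
Qed.

Lemma conn0 p v : sm (fun=> 0) p -> nab p v (fun=> 0) = 0.
Proof.
move=> s0; have := conn_leibniz nabP v (smooth_at_cst (0 : R^o) p) s0.
by under eq_fun do rewrite scaler0; rewrite dir_deriv_cst !scale0r addr0.
Qed.

End LinearConnection.

Section SpinConnection.
Context {R : realType} {M : manifold R 6} {g : oriented_riemannian M}.
Context {S : spinor_bundle g} {D : levi_civita g} (N : spin_connection S D).
Implicit Types (x : M) (eta : M -> 'cV[R]_8).

Definition frame_spinor x (i : 'I_8) (y : M) : 'cV[R]_8 := col i (sframe S x y).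

Lemma sframe_unit x : \forall y \near x, sframe S x y \in unitmx.
Proof.
have := open_nbhs_nbhs (sdom_nbhs S x); apply: filterS => y.
by move=> /sframe_orthonormal /mulmx1_unit[].
Qed.

Lemma smooth_spinor_frame x (c : M -> 'cV[R]_8) : smooth_at c x ->
  smooth_spinor S (fun y => sframe S x y *m c y) x.
Proof.
apply: near_eq_smooth_at; apply: filterS (sframe_unit x) => y uy.
by rewrite mulKmx.
Qed.

Lemma smooth_frame_spinor x i : smooth_spinor S (frame_spinor x i) x.
Proof.
have := smooth_spinor_frame (smooth_at_cst (delta_mx i 0 : 'cV[R]_8) x).
by under eq_fun do rewrite -colE.
Qed.

Lemma smooth_spinor0 x : smooth_spinor S (fun=> 0) x.
Proof.
rewrite /smooth_spinor; under eq_fun do rewrite mulmx0.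
exact: smooth_at_cst.
Qed.

Lemma smooth_spinorD eta eta' x : smooth_spinor S eta x ->
  smooth_spinor S eta' x -> smooth_spinor S (fun y => eta y + eta' y) x.
Proof.
move=> se se'; rewrite /smooth_spinor; under eq_fun do rewrite mulmxDr.
exact: smooth_atD.
Qed.

Lemma smooth_spinor_scale (f : M -> R^o) eta x : smooth_at f x ->
  smooth_spinor S eta x -> smooth_spinor S (fun y => f y *: eta y) x.
Proof.
move=> sf se; rewrite /smooth_spinor; under eq_fun do rewrite -scalemxAr.
exact: smooth_at_scale.
Qed.

Lemma smooth_spinor_sum (I : Type) (r : seq I) (eta : I -> M -> 'cV[R]_8) x :
  (forall i, smooth_spinor S (eta i) x) ->
  smooth_spinor S (fun y => \sum_(i <- r) eta i y) x.
Proof.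
move=> se; elim: r => [|i r IH].
  by under eq_fun do rewrite big_nil; exact: smooth_spinor0.
by under eq_fun do rewrite big_cons; exact: smooth_spinorD.
Qed.

Lemma snab_sum (I : Type) (r : seq I) (eta : I -> M -> 'cV[R]_8) x v :
  (forall i, smooth_spinor S (eta i) x) ->
  N x v (fun y => \sum_(i <- r) eta i y) = \sum_(i <- r) N x v (eta i).
Proof.
move=> se; elim: r => [|i r IH].
  under eq_fun do rewrite big_nil; rewrite big_nil.
  exact: conn0 (snab_connection N) _ _ (smooth_spinor0 x).
under eq_fun do rewrite big_cons.
rewrite big_cons -IH; apply: (conn_add (snab_connection N)) => //.
exact: smooth_spinor_sum.
Qed.

Lemma smooth_at_coord k l (c : M -> 'M[R]_(k, l)) x i j :
  smooth_at c x -> smooth_at (fun y => c y i j : R^o) x.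
Proof. exact: (smooth_at_linear (@mx_coord_continuous _ _ _ i j)). Qed.

Lemma frame_spinor_sum x y (c : 'cV[R]_8) :
  sframe S x y *m c = \sum_(i < 8) c i 0 *: frame_spinor x i y.
Proof.
apply/colP => a; rewrite mxE summxE; apply: eq_bigr => i _.
by rewrite !mxE mulrC.
Qed.

(** The axiom [clif_smooth] concerns the frame spinors only; a general spinor is expanded in the
    frame with smooth coefficients. *)
Lemma smooth_spinor_clif Y eta x : smooth_field Y x -> smooth_spinor S eta x ->
  smooth_spinor S (fun y => clif S y (Y y) *m eta y) x.
Proof.
move=> sY se.
have h i : smooth_spinor S
    (fun y => (invmx (sframe S x y) *m eta y) i 0 *:
      (clif S y (Y y) *m frame_spinor x i y)) x.
  apply: smooth_spinor_scale; first exact: smooth_at_coord.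
  rewrite /smooth_spinor; under eq_fun do rewrite mulmxA.
  exact: clif_smooth.
apply: near_eq_smooth_at (smooth_spinor_sum (index_enum 'I_8) h).
apply: filterS (sframe_unit x) => y uy; congr (_ *m _).
under eq_bigr do rewrite scalemxAr.
by rewrite -mulmx_sumr -frame_spinor_sum mulKVmx.
Qed.

(** The frame expansion is guaranteed to equal [eta] only near x, where the frame is known to be
    invertible; [conn_local] allows the replacement. *)
Lemma snab_frame_sum eta x v : smooth_spinor S eta x ->
  let c y := invmx (sframe S x y) *m eta y in
  N x v eta = \sum_(i < 8) (dir_deriv x v (fun y => c y i 0 : R^o) *:
    frame_spinor x i x + c x i 0 *: N x v (frame_spinor x i)).
Proof.
move=> se c.
have sc i : smooth_at (fun y => c y i 0 : R^o) x by exact: smooth_at_coord.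
have h i : smooth_spinor S (fun y => c y i 0 *: frame_spinor x i y) x.
  exact: smooth_spinor_scale (smooth_frame_spinor x i).
rewrite (@conn_local _ _ _ _ _ _ (snab_connection N) x v eta (fun y =>
  \sum_(i < 8) c y i 0 *: frame_spinor x i y)) //.
- rewrite snab_sum //; apply: eq_bigr => i _.
  by rewrite (conn_leibniz (snab_connection N) _ (sc i)) //; exact: smooth_frame_spinor.
- exact: smooth_spinor_sum.
- by apply: filterS (sframe_unit x) => y uy; rewrite -frame_spinor_sum mulKVmx.
Qed.

Section Twisted.
Context {m : nat} {G : lie_group R m} {P : principal_bundle M G}.
Variable A : principal_connection P.

(** The product rule does not depend on the decomposition into simple tensors: expanding every
    [eta a] in the spinor frame leads back to the defining one. It is needed because epsilon.psi
    comes as a sum of terms (e_a.psi) times a coefficient, and not in terms of the frame. *)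
Lemma nabla_tA_leibniz t T x v (I : finType) (eta : I -> M -> 'cV[R]_8)
    (E : I -> M -> 'rV[R]_m) (Xi : M -> 'M[R]_(8, m)) :
  (forall a, smooth_spinor S (eta a) x) -> (forall a, diff_ad (P:=P) (E a) x) ->
  (\near x, Xi x = \sum_a eta a x *m E a x) ->
  nabla_tA N t T A x v Xi =
  \sum_a (N x v (eta a) *m E a x + eta a x *m nabla_ad A x v (E a)) +
  (t / 4) *: (cl_form S x (Defs.contract v (T x : _ -> R^o)) *m Xi x).
Proof.
move=> se dE XiE.
pose c a y := invmx (sframe S x y) *m eta a y.
pose s i y := row i (invmx (sframe S x y) *m Xi y).
have sE i : \near x, s i x = \sum_a c a x i 0 *: E a x.
  apply: filterS XiE => y; rewrite /s => ->.
  rewrite mulmx_sumr linear_sum; apply: eq_bigr => a _ /=.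
  rewrite mulmxA -/(c a y); apply/rowP => j.
  by rewrite mxE [LHS]mxE big_ord1 [RHS]mxE.
have sc a i : diff_at (fun y => c a y i 0 : R^o) x.
  exact/smooth_diff_at/smooth_at_coord/se.
have ns i : nabla_ad A x v (s i) = \sum_a (dir_deriv x v (fun y => c a y i 0 : R^o)
    *: E a x + c a x i 0 *: nabla_ad A x v (E a)).
  rewrite (near_eq_nabla_ad A v (sE i)) nabla_ad_sum => [|a]; last exact: diff_ad_scale.
  by apply: eq_bigr => a _; exact: nabla_ad_scale.
have ux := nbhs_singleton (sframe_unit x).
have fs : \sum_(i < 8) frame_spinor x i x *m s i x = Xi x.
  rewrite -[RHS](mulKVmx ux); apply/matrixP => a b; rewrite summxE mxE.
  by apply: eq_bigr => i _; rewrite !mxE big_ord1 !mxE.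
rewrite /nabla_tA /nabla_t.
under eq_bigr do rewrite mulmxDl addrAC.
rewrite big_split /=; congr (_ + _); last first.
  rewrite [RHS](_ : _ = (t / 4) *: (cl_form S x (Defs.contract v (T x : _ -> R^o)) *m
    \sum_(i < 8) frame_spinor x i x *m s i x)); last by rewrite fs.
  rewrite mulmx_sumr scaler_sumr; apply: eq_bigr => i _.
  by rewrite -scalemxAl mulmxA.
under [LHS]eq_bigr => i _.
  rewrite -/(s i x) -/(s i) ns (nbhs_singleton (sE i)) !mulmx_sumr -big_split /=.
  over.
rewrite exchange_big /=; apply: eq_bigr => a _.
have -> : N x v (eta a) = \sum_(i < 8) (dir_deriv x v (fun y => c a y i 0 : R^o) *:
    frame_spinor x i x + c a x i 0 *: N x v (frame_spinor x i)).
  exact: snab_frame_sum v (se a).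
have -> : eta a x = \sum_(i < 8) c a x i 0 *: frame_spinor x i x.
  by rewrite -frame_spinor_sum mulKVmx.
rewrite !mulmx_suml -big_split /=; apply: eq_bigr => i _.
rewrite mulmxDr mulmxDl addrA -!scalemxAr -!scalemxAl; congr (_ + _).
by rewrite addrC.
Qed.

End Twisted.
End SpinConnection.

(** * Alternating sums *)

Section IncreasingSums.
Context {n : nat} {V : nmodType}.

Definition incr {k} (a : {ffun 'I_k -> 'I_n}) : bool :=
  [forall i : 'I_k, forall j : 'I_k, (i < j)%N ==> (a i < a j)%N].

Lemma incrP {k} (a : {ffun 'I_k -> 'I_n}) :
  reflect (forall i j : 'I_k, (i < j)%N -> (a i < a j)%N) (incr a).
Proof.
apply: (iffP forallP) => [h i j ij|h i].
  by have /forallP/(_ j)/implyP := h i; exact.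
by apply/forallP => j; apply/implyP; exact: h.
Qed.

Lemma ord1P (P : 'I_1 -> Prop) : P 0 -> forall i, P i.
Proof. by move=> P0 i; rewrite ord1. Qed.

Lemma ord2P (P : 'I_2 -> Prop) : P 0 -> P 1 -> forall i, P i.
Proof.
move=> P0 P1 [[|[|//]] h].
  by rewrite (_ : Ordinal h = 0) //; apply/val_inj.
by rewrite (_ : Ordinal h = 1) //; apply/val_inj.
Qed.

Definition o2 : 'I_3 := @Ordinal 3 2 isT.

Lemma ord3P (P : 'I_3 -> Prop) : P 0 -> P 1 -> P o2 -> forall i, P i.
Proof.
move=> P0 P1 P2 [[|[|[|//]]] h].
- by rewrite (_ : Ordinal h = 0) //; apply/val_inj.
- by rewrite (_ : Ordinal h = 1) //; apply/val_inj.
- by rewrite (_ : Ordinal h = o2) //; apply/val_inj.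
Qed.

Definition fun2 {T} (a b : T) (i : 'I_2) : T := if val i is 0%N then a else b.

Definition fun3 {T} (a b c : T) (i : 'I_3) : T :=
  match val i with 0%N => a | 1%N => b | _ => c end.

Lemma sum_incr1 (F : {ffun 'I_1 -> 'I_n} -> V) :
  \sum_(a | incr a) F a = \sum_(i < n) F [ffun=> i].
Proof.
rewrite (reindex (fun i : 'I_n => [ffun=> i])) /=; last first.
  exists (fun a : {ffun 'I_1 -> 'I_n} => a 0) => [i _|a _]; first by rewrite ffunE.
  by apply/ffunP; apply: ord1P; rewrite ffunE.
by apply: eq_bigl => i; apply/incrP => a b; rewrite !ord1.
Qed.

Lemma sum_incr2 (F : {ffun 'I_2 -> 'I_n} -> V) :
  \sum_(a | incr a) F a =
  \sum_(i < n) \sum_(j < n | (i < j)%N) F (finfun (fun2 i j)).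
Proof.
rewrite pair_big_dep /=.
rewrite (reindex (fun p : 'I_n * 'I_n => finfun (fun2 p.1 p.2))) /=; last first.
  exists (fun a : {ffun 'I_2 -> 'I_n} => (a 0, a 1)) => [[i j] _|a _].
    by rewrite !ffunE.
  by apply/ffunP; apply: ord2P; rewrite ffunE.
apply: eq_bigl => -[i j] /=; apply/incrP/idP => [/(_ 0 1 isT)|ij].
  by rewrite !ffunE.
by apply: ord2P; apply: ord2P => //; rewrite !ffunE.
Qed.

Lemma sum_incr3 (F : {ffun 'I_3 -> 'I_n} -> V) :
  \sum_(a | incr a) F a =
  \sum_(i < n) \sum_(j < n | (i < j)%N) \sum_(k < n | (j < k)%N)
    F (finfun (fun3 i j k)).
Proof.
under [RHS]eq_bigr do rewrite pair_big_dep /=.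
rewrite pair_big_dep /=.
rewrite (reindex (fun p : 'I_n * ('I_n * 'I_n) =>
  finfun (fun3 p.1 p.2.1 p.2.2))) /=; last first.
  exists (fun a : {ffun 'I_3 -> 'I_n} => (a 0, (a 1, a o2))) => [[i [j k]] _|a _].
    by rewrite !ffunE.
  by apply/ffunP; apply: ord3P; rewrite ffunE.
apply: eq_bigl => -[i [j k]] /=; apply/incrP/idP => [h|/andP[ij jk]].
  have := h 0 1 isT; have := h 1 o2 isT; rewrite !ffunE /= => h1 h2.
  by rewrite h2.
have ik := ltn_trans ij jk.
by apply: ord3P; apply: ord3P => //; rewrite !ffunE.
Qed.

(** Each increasing triple is met three times on the left, according to whether b is its smallest,
    middle or largest member; if b coincides with i or j, the term vanishes. *)
Lemma sum_symmetric3 (X : 'I_n -> 'I_n -> 'I_n -> V) :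
  (forall i j k, X i j k = X j i k) -> (forall i j k, X i j k = X i k j) ->
  (forall i k, X i i k = 0) ->
  \sum_(b < n) \sum_(i < n) \sum_(j < n | (i < j)%N) X b i j =
  (\sum_(i < n) \sum_(j < n | (i < j)%N) \sum_(k < n | (j < k)%N) X i j k) *+ 3.
Proof.
move=> X12 X23 X0.
pose Y (i j k : 'I_n) := if (i < j)%N && (j < k)%N then X i j k else 0.
have YE : \sum_(i < n) \sum_(j < n | (i < j)%N) \sum_(k < n | (j < k)%N) X i j k =
    \sum_(i < n) \sum_(j < n) \sum_(k < n) Y i j k.
  apply: eq_bigr => i _; rewrite big_mkcond; apply: eq_bigr => j _.
  rewrite /Y; case: ifP => ij /=; first by rewrite big_mkcond.
  by rewrite big1.
have XE (b i j : 'I_n) : (if (i < j)%N then X b i j else 0) = Y b i j + Y i b j + Y i j b.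
  rewrite /Y; case: (ltnP i j) => ij; last first.
    rewrite andbF /= addr0.
    case: ifP => [/andP[h h']|_]; last by rewrite addr0.
    by have := leq_trans (ltn_trans h h') ij; rewrite ltnn.
  rewrite /= andbT.
  case: (ltngtP b i) => bi.
  - have -> : (j < b)%N = false by apply: contraTF ij => jb; rewrite -leqNgt (ltnW (ltn_trans jb bi)).
    by rewrite !addr0.
  - case: (ltngtP b j) => bj /=; rewrite ?add0r ?addr0 //.
    - by rewrite X12 X23.
    by rewrite (val_inj bj) X23 X0.
  - have -> : (j < b)%N = false by rewrite bi ltnNge (ltnW ij).
    by rewrite !addr0 (val_inj bi) X0.
rewrite YE mulrS mulr2n.
transitivity (\sum_(b < n) \sum_(i < n) \sum_(j < n) (Y b i j + Y i b j + Y i j b)).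
  apply: eq_bigr => b _; apply: eq_bigr => i _; rewrite big_mkcond.
  by apply: eq_bigr => j _; rewrite XE.
under eq_bigr do under eq_bigr do rewrite !big_split /=.
under eq_bigr do rewrite !big_split /=.
rewrite !big_split /= -addrA; congr (_ + (_ + _)).
  by rewrite exchange_big.
rewrite exchange_big; apply: eq_bigr => i _; rewrite exchange_big.
by apply: eq_bigr.
Qed.

End IncreasingSums.

(** * Exchange of arguments in alternating maps *)

Section Alternating.
Context {R : realType} {n k : nat} {W : lmodType R}.
Variable w : ('I_k -> 'rV[R]_n) -> W.
Hypothesis alt_w : Defs.alternating w.

Definition upd (i : 'I_k) (u : 'rV[R]_n) (v : 'I_k -> 'rV[R]_n) : 'I_k -> 'rV[R]_n :=
  fun j => if j == i then u else v j.

Lemma updC i j u u' v : i != j -> upd i u (upd j u' v) = upd j u' (upd i u v).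
Proof.
move=> ij; apply/funext => l; rewrite /upd.
by case: (eqVneq l i) => [->|//]; rewrite (negbTE ij).
Qed.

Lemma alternating_upd i a u u' v :
  w (upd i (a *: u + u') v) = a *: w (upd i u v) + w (upd i u' v).
Proof. exact: alt_w.1. Qed.

Lemma alternating_swap i j u u' v : i != j ->
  w (upd i u (upd j u' v)) = - w (upd i u' (upd j u v)).
Proof.
move=> ij.
have w0 a : w (upd i a (upd j a v)) = 0.
  by apply: (alt_w.2 _ i j ij); rewrite /upd !eqxx eq_sym (negbTE ij).
(* Polarization: expanding w(.., u + u', .., u + u', ..) = 0 leaves the two mixed terms. The scalar
   1 fits the form in which multilinearity is stated. *)
have := w0 (1 *: u + u').
rewrite alternating_upd !(updC _ _ _ ij) !alternating_upd -!(updC _ _ _ ij) !w0.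
rewrite !scale1r add0r addr0 => /eqP; rewrite addr_eq0 => /eqP.
by [].
Qed.

End Alternating.

Section Alternating3.
Context {R : realType} {n : nat} {W : lmodType R}.
Variable w : ('I_3 -> 'rV[R]_n) -> W.
Hypothesis alt_w : Defs.alternating w.

Lemma alternating3_swap01 a b c : w (fun3 a b c) = - w (fun3 b a c).
Proof.
have := @alternating_swap R n 3 W w alt_w 0 1 a b (fun3 a b c) isT.
have -> : upd 0 a (upd 1 b (fun3 a b c)) = fun3 a b c.
  by apply/funext; apply: ord3P.
by have -> : upd 0 b (upd 1 a (fun3 a b c)) = fun3 b a c
  by apply/funext; apply: ord3P.
Qed.

Lemma alternating3_swap12 a b c : w (fun3 a b c) = - w (fun3 a c b).
Proof.
have := @alternating_swap R n 3 W w alt_w 1 o2 b c (fun3 a b c) isT.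
have -> : upd 1 b (upd o2 c (fun3 a b c)) = fun3 a b c.
  by apply/funext; apply: ord3P.
by have -> : upd 1 c (upd o2 b (fun3 a b c)) = fun3 a c b
  by apply/funext; apply: ord3P.
Qed.

Lemma alternating3_eq0 a c : w (fun3 a a c) = 0.
Proof. exact: (alt_w.2 _ 0 1 isT). Qed.

End Alternating3.

(** * Clifford relations *)

Section CliffordRelations.
Context {R : realType} {e : 'I_6 -> 'M[R]_8}.
Hypothesis e_sq : forall i, e i * e i = -1.
Hypothesis e_anti : forall i j, i != j -> e i * e j = - (e j * e i).
Hypothesis e_skew : forall i, (e i)^T = - e i.

(** The term b = a gives -e_a and each of the other five gives e_a, so the constant is 6 - 2. *)
Lemma clifford_sandwich a : \sum_(b < 6) e b * e a * e b = 4 *: e a.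
Proof.
rewrite (bigD1 a) //= e_sq mulN1r.
rewrite (eq_bigr (fun=> e a)) => [|b ba]; last first.
  by rewrite (e_anti ba) mulNr -mulrA e_sq mulrN1 opprK.
rewrite sumr_const cardC1 card_ord scaler_nat.
by rewrite -[e a *+ 5]/(e a + e a *+ 4) addKr.
Qed.

(** Folding the pairs c < b onto b < c by anticommutation leaves the antisymmetric part of Y; the
    squares -1 on the diagonal leave minus the trace. These become d^A epsilon and the
    divergence. *)
Lemma clifford_split k (Y : 'I_6 -> 'I_6 -> 'M[R]_(8, k)) :
  \sum_(b < 6) \sum_(c < 6) (e b * e c) *m Y b c =
  \sum_(b < 6) \sum_(c < 6 | (b < c)%N) (e b * e c) *m (Y b c - Y c b) -
  \sum_(b < 6) Y b b.
Proof.
pose L := \sum_(b < 6) \sum_(c < 6 | (b < c)%N) (e b * e c) *m Y b c.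
pose U := \sum_(b < 6) \sum_(c < 6 | (b < c)%N) (e b * e c) *m Y c b.
have -> : \sum_(b < 6) \sum_(c < 6 | (b < c)%N) (e b * e c) *m (Y b c - Y c b) =
    L - U.
  rewrite -sumrB; apply: eq_bigr => b _; rewrite -sumrB.
  by apply: eq_bigr => c _; rewrite mulmxBr.
have -> : - U = \sum_(b < 6) \sum_(c < 6 | (c < b)%N) (e b * e c) *m Y b c.
  rewrite -sumrN (eq_bigr (fun b : 'I_6 => \sum_(c < 6) (if (b < c)%N then
      (e c * e b) *m Y c b else 0))); last first.
    move=> b _; rewrite -sumrN big_mkcond; apply: eq_bigr => c _.
    case: ifP => // bc; rewrite -mulNmx -e_anti //.
    by apply: contraTneq bc => ->; rewrite ltnn.
  rewrite exchange_big; apply: eq_bigr => b _.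
  by rewrite [RHS]big_mkcond; apply: eq_bigr.
rewrite -sumrN -!big_split /=; apply: eq_bigr => b _.
rewrite (bigID (fun c : 'I_6 => (b < c)%N)) /= -addrA; congr (_ + _).
rewrite (bigD1 b) ?ltnn //= e_sq mulNmx mul1mx addrC; congr (_ - _).
by apply: eq_bigl => c; rewrite -leqNgt [RHS]ltn_neqAle andbC.
Qed.

Lemma clifford_pair_skew i j : i != j -> (e i * e j)^T = - (e i * e j).
Proof.
by move=> ij; rewrite -!mulmxE trmx_mul !e_skew mulNmx mulmxN opprK mulmxE e_anti // eq_sym.
Qed.

Lemma quadratic_skew n (K : 'M[R]_n) (u : 'cV[R]_n) :
  K^T = - K -> u^T *m K *m u = 0.
Proof.
move=> Kskew; have h : (u^T *m K *m u)^T = - (u^T *m K *m u).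
  by rewrite !trmx_mul trmxK Kskew mulNmx mulmxN mulmxA.
have e0 : u^T *m K *m u = (u^T *m K *m u)^T 
    by apply/matrixP => i j; rewrite [RHS]mxE !ord1.
move: h; rewrite -e0 => /eqP; rewrite -addr_eq0 -mulr2n -scaler_nat scaler_eq0.
by rewrite pnatr_eq0 => /eqP.
Qed.

Let signCA (x y : 'M[R]_8) k : x * ((-1) ^+ k * y) = (-1) ^+ k * (x * y).
Proof. by rewrite mulrA commr_sign -mulrA. Qed.

Let prod_anticomm (s : seq 'I_6) i : i \notin s ->
  (\prod_(j <- s) e j) * e i = (-1) ^+ size s * (e i * \prod_(j <- s) e j).
Proof.
elim: s => [|a s IH]; first by rewrite !big_nil mul1r mulr1 mul1r.
rewrite inE negb_or => /andP[ia /IH {}IH].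
rewrite !big_cons -mulrA IH /= signCA (mulrA (e a)).
by rewrite (e_anti (i := a)) 1?eq_sym // exprS mulN1r !mulNr mulrN -mulrA.
Qed.

Let omega := \prod_(i < 6) e i.

(** Among the six factors of omega, e_i commutes with itself and anticommutes with the other five:
    the total sign is odd. *)
Let omega_anticomm i : omega * e i = - (e i * omega).
Proof.
have h (s : seq 'I_6) : uniq s -> i \in s ->
    (\prod_(j <- s) e j) * e i = - (-1) ^+ size s * (e i * \prod_(j <- s) e j).
  elim: s => [//|a s IH] /= /andP[as_ us]; rewrite inE !big_cons => /predU1P[ia|is_].
    rewrite {}ia -mulrA prod_anticomm // exprS mulN1r opprK.
    exact: signCA.
  have ai : a != i by apply: contraNneq as_ => ->.
  rewrite -mulrA IH // exprS mulN1r opprK mulNr mulrN signCA.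
  by rewrite (mulrA (e a)) (e_anti ai) mulNr mulrN opprK -mulrA.
have := h (index_enum 'I_6) (index_enum_uniq _) (mem_index_enum _).
have -> : size (index_enum 'I_6) = 6 by rewrite [index_enum _]unlock -enumT size_enum_ord.
by rewrite -/omega => ->; rewrite -signr_odd expr0 mulN1r.
Qed.

(** Transposition gives one sign per skew factor and one per pair when the order is restored. For
    six factors the exponent is 6 + 15, which is odd. *)
Let prod_tr (s : seq 'I_6) : uniq s ->
  (\prod_(j <- s) e j)^T =
  (-1) ^+ (size s + 'C(size s, 2)) * \prod_(j <- s) e j.
Proof.
elim: s => [|a s IH] /=; first by rewrite !big_nil mulr1 trmx1.
move=> /andP[as_ us]; rewrite !big_cons -mulmxE trmx_mul IH //.
rewrite e_skew mulmxE mulrN -mulrA prod_anticomm // (mulrA ((-1) ^+ _)) -exprD.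
by rewrite binS bin1 addSn exprS mulN1r mulNr addnA.
Qed.

Let omega_tr : omega^T = - omega.
Proof.
rewrite prod_tr ?index_enum_uniq //.
have -> : size (index_enum 'I_6) = 6 by rewrite [index_enum _]unlock -enumT size_enum_ord.
by rewrite -signr_odd /= expr1 mulN1r.
Qed.

Let omega_orth : omega * omega^T = 1.
Proof.
rewrite /omega; elim: (index_enum _) => [|a s IH]; first by rewrite big_nil trmx1 mulr1.
rewrite big_cons -mulmxE trmx_mul mulmxA mulmxE -[e a * _ * _]mulrA IH mulr1.
by rewrite e_skew mulrN e_sq opprK.
Qed.

Let omega_prod k (a : 'I_k -> 'I_6) :
  omega * \prod_(i < k) e (a i) = (-1) ^+ k * ((\prod_(i < k) e (a i)) * omega).
Proof.
elim: k a => [|k IH] a; first by rewrite !big_ord0 mulr1 !mul1r.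
rewrite !big_ord_recl mulrA omega_anticomm mulNr -!mulrA.
by rewrite (IH (fun i => a (lift ord0 i))) signCA exprS mulN1r mulNr.
Qed.

(** Only parity is used: conjugation by omega changes the sign of the odd form and fixes the even
    one, whence the index set of even size [k.*2]. *)
Lemma clifford_three_form_eq0 k l (P : {ffun 'I_3 -> 'I_6} -> R)
    (Q : {ffun 'I_k.*2 -> 'I_6} -> R) (psi : 'cV[R]_8) :
  l *: (psi *m psi^T) = 1%:M + \sum_(a | incr a) P a *: \prod_(i < 3) e (a i) -
    \sum_(a | incr a) Q a *: \prod_(i < k.*2) e (a i) ->
  forall j, (\sum_(a | incr a) P a *: \prod_(i < 3) e (a i)) *m (e j *m psi) = 0.
Proof.
set MP := \sum_(a | _) _; set MQ := \sum_(a | _) _ => psiE j.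
have conjP : omega * MP * omega^T = - MP.
  have -> : omega * MP = - (MP * omega).
    rewrite mulr_sumr mulr_suml -sumrN; apply: eq_bigr => a _.
    rewrite -scalerAr -scalerAl -scalerN omega_prod.
    by rewrite -signr_odd expr1 mulN1r.
  by rewrite mulNr -mulrA omega_orth mulr1.
have conjQ : omega * MQ * omega^T = MQ.
  have -> : omega * MQ = MQ * omega.
    rewrite mulr_sumr mulr_suml; apply: eq_bigr => a _.
    rewrite -scalerAr -scalerAl omega_prod.
    by rewrite -signr_odd odd_double mul1r.
  by rewrite -mulrA omega_orth mulr1.
pose phi := omega *m psi.
have phiE : l *: (phi *m phi^T) = 1%:M - MP - MQ.
  have : l *: (phi *m phi^T) = omega * (l *: (psi *m psi^T)) * omega^T.
    rewrite -scalerAr -scalerAl -!mulmxE /phi trmx_mul.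
    by rewrite !mulmxA.
  by rewrite psiE mulrBr mulrBl mulrDr mulrDl conjP conjQ mulr1 omega_orth.
have MPE : 2 *: MP = l *: (psi *m psi^T) - l *: (phi *m phi^T).
  by rewrite psiE phiE opprB addrA subrK opprB addrC addrA subrK scaler_nat mulr2n.
have psi0 : psi^T *m e j *m psi = 0 by apply: quadratic_skew.
(* Up to sign this is the quadratic form of omega e_j at psi, and omega e_j is skew because both
   factors are skew and anticommute. *)
have phi0 : phi^T *m e j *m psi = 0.
  rewrite /phi trmx_mul omega_tr mulmxN mulNmx -mulmxA mulNmx.
  rewrite !mulmxA -(mulmxA psi^T) quadratic_skew ?oppr0 //.
  by rewrite trmx_mul omega_tr e_skew mulmxN mulNmx opprK !mulmxE omega_anticomm opprK.
have : 2 *: (MP *m (e j *m psi)) = 0.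
  rewrite scalemxAl MPE mulmxBl -!scalemxAl -!mulmxA.
  by rewrite ![_^T *m (e j *m psi)]mulmxA psi0 phi0 !mulmx0 !scaler0 subrr.
by move/eqP; rewrite scaler_eq0 pnatr_eq0 /= => /eqP.
Qed.

End CliffordRelations.

(** * Orthonormal coordinate frames *)

Section Determinants.
Context {R : comNzRingType} {k : nat}.

(** It has the same shape as [contract], so that the contracted volume form is by definition a
    determinant of this kind. *)
Definition replace_row0 {l} (u : 'rV[R]_l) (v : 'I_k -> 'rV[R]_l) : 'M[R]_(k.+1, l) :=
  \matrix_(i < k.+1) oapp v u (unlift ord0 i).

Lemma replace_row0_mul {l l'} (u : 'rV[R]_l) (v : 'I_k -> 'rV[R]_l) (B : 'M[R]_(l, l')) :
  replace_row0 u v *m B = replace_row0 (u *m B) (fun j => v j *m B).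
Proof. by apply/row_matrixP => i; rewrite row_mul !rowK; case: unlift. Qed.

Lemma det_replace_row0 (u : 'rV[R]_k.+1) v :
  \det (replace_row0 u v) = \sum_(l < k.+1) u 0 l * cofactor (replace_row0 0 v) ord0 l.
Proof.
rewrite (expand_det_row _ ord0); apply: eq_bigr => l _; congr (_ * _).
  by rewrite mxE unlift_none.
rewrite /cofactor; congr (_ * \det _); apply/matrixP => i j.
by rewrite !mxE liftK.
Qed.

(** By linearity in the first row, the sum depends on f and s only through the tensor with matrix
    \sum_a (f a)^T s a. This permits a change of basis in the Hodge dual. *)
Lemma sum_det_replace_row0 (I : finType) l (f : I -> 'rV[R]_k.+1) (s : I -> 'rV[R]_l) v :
  \sum_a \det (replace_row0 (f a) v) *: s a =
  (\row_j cofactor (replace_row0 0 v) ord0 j) *m \sum_a (f a)^T *m s a.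
Proof.
rewrite mulmx_sumr; apply: eq_bigr => a _; rewrite mulmxA.
rewrite [X in X *m _]mx11_scalar mul_scalar_mx; congr (_ *: _).
rewrite det_replace_row0 mxE; apply: eq_bigr => j _.
by rewrite [(_)^T _ _]mxE [X in _ = X * _]mxE mulrC.
Qed.

(** The sign of the i-th Koszul term and the omission of the i-th vector combine into a cofactor. *)
Lemma cofactor_replace_row0 (C : 'M[R]_k.+1) (i a : 'I_k.+1) :
  (-1) ^+ i * \det (replace_row0 (delta_mx 0 a) (fun j => row (lift i j) C)) =
  cofactor C i a.
Proof.
rewrite det_replace_row0 (bigD1 a) //= mxE !eqxx mul1r big1 ?addr0; last first.
  by move=> l la; rewrite mxE (negbTE la) andbF mul0r.
rewrite /cofactor mulrA -exprD add0n; congr (_ * \det _); apply/matrixP => i' j'.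
by rewrite !mxE liftK !mxE.
Qed.

Lemma sum_cofactor (C : 'M[R]_k.+1) (a b : 'I_k.+1) :
  \sum_(i < k.+1) cofactor C i a * C i b = \det C *+ (a == b).
Proof.
transitivity ((\adj C *m C) a b); last by rewrite mul_adj_mx mxE.
by rewrite mxE; apply: eq_bigr => i _; rewrite mxE.
Qed.

End Determinants.

Section OrthonormalBasis.
Context {R : realType} {n : nat} {M : manifold R n} (g : oriented_riemannian M).
Implicit Types x y : M.

Lemma onb_unit y : onb g y \in unitmx.
Proof. by have := onb_orthonormal g y; rewrite -mulmxA => /mulmx1_unit[]. Qed.

Lemma onb_gram y : metric g y *m ((onb g y)^T *m onb g y) = 1%:M.
Proof.
by have := onb_orthonormal g y; rewrite -mulmxA => /mulmx1C; rewrite mulmxA.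
Qed.

Lemma metric_unit y : metric g y \in unitmx.
Proof. by have /mulmx1_unit[] := onb_gram y. Qed.

(** The inverse metric does not see the choice of orthonormal basis, and it is what sums over such
    bases reduce to. *)
Lemma onb_gramE y : (onb g y)^T *m onb g y = invmx (metric g y).
Proof. by rewrite -[LHS](mulKmx (metric_unit y)) onb_gram mulmx1. Qed.

Lemma det_metric y : \det (metric g y) = (\det (onb g y) ^+ 2)^-1.
Proof.
have /(congr1 determinant) := onb_gram y.
rewrite !det_mulmx det_tr det1 -expr2 => h.
have u : \det (onb g y) ^+ 2 != 0.
  by rewrite expf_neq0 // -unitfE -unitmxE onb_unit.
by rewrite -[LHS](mulfK u) h mul1r.
Qed.

Lemma gdot_onb x a b : gdot g x (row a (onb g x)) (row b (onb g x)) = (a == b)%:R.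
Proof.
have /matrixP/(_ a b) := onb_orthonormal g x; rewrite [RHS]mxE => <-.
by rewrite /gdot -!row_mul tr_row !mxE; apply: eq_bigr => i _; rewrite !mxE.
Qed.

Lemma gdot_onb_sum x v : v = \sum_c gdot g x v (row c (onb g x)) *: row c (onb g x).
Proof.
rewrite -[LHS]mulmx1 -(onb_gram x) !mulmxA -[LHS]/((v *m metric g x *m (onb g x)^T) *m onb g x).
rewrite mulmx_sum_row; apply: eq_bigr => c _; congr (_ *: _).
by rewrite /gdot tr_row !mxE; apply: eq_bigr => i _; rewrite !mxE.
Qed.

Lemma gdotC x v u : gdot g x v u = gdot g x u v.
Proof.
rewrite /gdot -[LHS]/((v *m metric g x *m u^T) 0 0).
have -> : v *m metric g x *m u^T = (u *m metric g x *m v^T)^T.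
  by rewrite !trmx_mul trmxK Defs.metric_sym mulmxA.
by rewrite mxE.
Qed.

End OrthonormalBasis.

(** The inverse metric h^-1 expanded in an arbitrary frame f, with the inverse Gram matrix as
    coefficients. *)
Lemma gram_invmx (R : fieldType) n (f h : 'M[R]_n) : f \in unitmx -> h \in unitmx ->
  f^T *m invmx (f *m h *m f^T) *m f = invmx h.
Proof.
move=> uf uh; have uft : f^T \in unitmx by rewrite unitmx_tr.
have e : (f *m h *m f^T) *m (invmx f^T *m invmx h *m invmx f) = 1%:M.
  by rewrite !mulmxA mulmxK // mulmxK // mulmxV.
have uF : f *m h *m f^T \in unitmx by rewrite !unitmx_mul uf uh uft.
have -> : invmx (f *m h *m f^T) = invmx f^T *m invmx h *m invmx f.
  by rewrite -[LHS]mulmx1 -e mulKmx.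
by rewrite !mulmxA mulmxV // mul1mx -mulmxA mulVmx // mulmx1.
Qed.

Lemma trmx_mul_sum_row (R : comNzRingType) n k l (F : 'M[R]_(n, k)) (B : 'M[R]_(n, l)) :
  F^T *m B = \sum_a (row a F)^T *m row a B.
Proof.
apply/matrixP => i j; rewrite mxE summxE; apply: eq_bigr => a _.
by rewrite [RHS]mxE big_ord1 !mxE.
Qed.

(** * One-forms and their covariant derivative in the coordinate frame *)

Section OneForms.
Context {R : realType} {n m : nat} {M : manifold R n} {G : lie_group R m}.
Context {PP : principal_bundle M G} (A : principal_connection PP).
Context (g : oriented_riemannian M) (D : levi_civita g).
Context (w : M -> ('I_1 -> 'rV[R]_n) -> 'rV[R]_m) (w_form : ad_form PP w).
Variable x : M.

Let dom y := cdom (chart_at x) y.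

Definition ofield (a : 'I_n) : M -> 'rV[R]_n := coord_field x (row a (onb g x)).

Definition oframe (y : M) : 'M[R]_n := onb g x *m tframe x y.

Lemma row_oframe a y : row a (oframe y) = ofield a y.
Proof. by rewrite row_mul. Qed.

Lemma oframe_unit y : dom y -> oframe y \in unitmx.
Proof. by move=> xy; rewrite unitmx_mul onb_unit tframe_unit. Qed.

Lemma ofield_id a : ofield a x = row a (onb g x).
Proof. by rewrite /ofield /coord_field tframe_id mulmx1. Qed.

Definition gram (y : M) : 'M[R]_n := oframe y *m metric g y *m (oframe y)^T.

Lemma gramE y a b : gram y a b = gdot g y (ofield a y) (ofield b y).
Proof.
rewrite -!row_oframe /gram /gdot -row_mul [LHS]mxE [RHS]mxE.
by apply: eq_bigr => i _; rewrite [row _ _ _ _]mxE; congr (_ * _); rewrite !mxE.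
Qed.

Lemma gram_unit y : dom y -> gram y \in unitmx.
Proof.
by move=> xy; rewrite /gram unitmx_mul unitmx_tr unitmx_mul oframe_unit // metric_unit.
Qed.

Lemma gram_id : gram x = 1%:M.
Proof. by rewrite /gram /oframe tframe_id mulmx1 onb_orthonormal. Qed.

Lemma diff_gram a b : diff_at (fun y => gram y a b : R^o) x.
Proof.
have sm := smooth_diff_at (metric_smooth g x).
have e i j : diff_at (fun y => (tframe x y *m metric g y *m (tframe x y)^T) i j : R^o) x.
  exact: (diff_at_linear (@mx_coord_continuous _ _ _ i j) sm).
have gE y : gram y a b = \sum_j (\sum_i onb g x a i *
    (tframe x y *m metric g y *m (tframe x y)^T) i j) * onb g x b j.
  have -> : gram y = onb g x *m (tframe x y *m metric g y *m (tframe x y)^T) *m (onb g x)^T.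
    by rewrite /gram /oframe trmx_mul !mulmxA.
  rewrite mxE; apply: eq_bigr => j _; rewrite [(onb g x)^T j b]mxE; congr (_ * _).
  by rewrite mxE.
under eq_fun do rewrite gE.
apply: diff_at_sum => j; apply: diff_atM; last exact: diff_at_cst.
by apply: diff_at_sum => i; apply: diff_atM => //; exact: diff_at_cst.
Qed.

Definition christoffel (b a : 'I_n) : 'rV[R]_n := D x (row b (onb g x)) (ofield a).

Lemma christoffel_sym b a : christoffel b a = christoffel a b.
Proof.
have := lc_torsion_free D (smooth_coord_field x (row b (onb g x)))
  (smooth_coord_field x (row a (onb g x))).
rewrite lie_bracket_coord_field -![coord_field _ _]/(ofield _) !ofield_id.
by move/eqP; rewrite subr_eq0 => /eqP.
Qed.

Lemma dir_deriv_gram c a b :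
  dir_deriv x (row c (onb g x)) (fun y => gram y a b : R^o) =
  gdot g x (christoffel c a) (row b (onb g x)) +
  gdot g x (christoffel c b) (row a (onb g x)).
Proof.
under eq_fun do rewrite gramE.
rewrite (lc_metric D); [|exact: smooth_coord_field|exact: smooth_coord_field].
by rewrite !ofield_id; congr (_ + _); exact: gdotC.
Qed.

Lemma one_form_linear y : linear (fun u => w y (fun=> u)).
Proof.
move=> a u v; have := (w_form.1 y).1 0 (fun=> 0) a u v.
have e (z : 'rV[R]_n) : (fun j : 'I_1 => if j == 0 then z else 0) = fun=> z.
  by apply/funext => j; rewrite ord1.
by rewrite !e.
Qed.

Definition form_mx (y : M) : 'M[R]_(n, m) := \matrix_i w y (fun=> delta_mx 0 i).

Lemma form_mxE y u : w y (fun=> u) = u *m form_mx y.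
Proof.
pose lw := GRing.isLinear.Build _ _ _ _ (fun u => w y (fun=> u)) (one_form_linear y).
pose f : {linear 'rV[R]_n -> 'rV[R]_m} := HB.pack (fun u => w y (fun=> u)) lw.
rewrite -[LHS]/(f u) {1}(row_sum_delta u) linear_sum mulmx_sum_row.
by apply: eq_bigr => i _; rewrite linearZ rowK.
Qed.

(** The form with its index raised, as an element of the tangent space tensor the adjoint fibre. It
    mentions no basis, so it mediates between [onb g y] and the coordinate frame. *)
Definition sharp (y : M) : 'M[R]_(n, m) := invmx (metric g y) *m form_mx y.

Lemma sharp_onb y :
  sharp y = \sum_a (row a (onb g y))^T *m w y (fun=> row a (onb g y)).
Proof.
rewrite /sharp -onb_gramE -mulmxA.
under eq_bigr do rewrite form_mxE -row_mul.
by rewrite -trmx_mul_sum_row.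
Qed.

(** The contravariant components w^a = \sum_b g^(ab) w(X_b) in the coordinate frame. *)
Definition coeff (a : 'I_n) (y : M) : 'rV[R]_m :=
  \sum_b (invmx (gram y)) a b *: w y (fun=> ofield b y).

Lemma coeffE a y : coeff a y = row a (invmx (gram y) *m oframe y *m form_mx y).
Proof.
rewrite -mulmxA row_mul mulmx_sum_row; apply: eq_bigr => b _.
by rewrite row_mul row_oframe form_mxE mxE.
Qed.

Lemma sharp_ofield y : dom y -> sharp y = \sum_a (ofield a y)^T *m coeff a y.
Proof.
move=> xy; rewrite /sharp -(gram_invmx (oframe_unit xy) (metric_unit g y)).
under eq_bigr do rewrite coeffE -row_oframe.
by rewrite -trmx_mul_sum_row -/(gram y) !mulmxA.
Qed.

Lemma form_ofield c y : dom y ->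
  w y (fun=> ofield c y) = \sum_a gram y c a *: coeff a y.
Proof.
move=> xy; rewrite form_mxE -row_oframe -row_mul.
have -> : oframe y *m form_mx y = gram y *m (invmx (gram y) *m oframe y *m form_mx y).
  by rewrite -(mulmxA (invmx _)) mulKVmx // gram_unit.
rewrite row_mul mulmx_sum_row; apply: eq_bigr => a _.
by rewrite coeffE mxE.
Qed.

Lemma diff_ad_form_ofield b : diff_ad (P := PP) (fun y => w y (fun=> ofield b y)) x.
Proof.
apply: smooth_diff_ad; apply: (w_form.2 x (fun=> ofield b)) => _.
exact: smooth_coord_field.
Qed.

Lemma near_dom : \near x, dom x.
Proof. exact: near_cdom (chart_at_dom x). Qed.

Lemma diff_ad_coeff a : diff_ad (P := PP) (coeff a) x.
Proof.
apply: diff_ad_sum => b; apply: diff_ad_scale; last exact: diff_ad_form_ofield.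
apply: diff_at_invmx; first exact: diff_gram.
  exact/gram_unit/chart_at_dom.
by apply: filterS near_dom => y; exact: gram_unit.
Qed.

(* The components of the covariant derivative of w, in the connection induced
   by A and the Levi-Civita connection. *)
Definition cov_deriv (b c : 'I_n) : 'rV[R]_m :=
  nabla_ad A x (row b (onb g x)) (coeff c) +
  \sum_a gdot g x (christoffel b a) (row c (onb g x)) *: coeff a x.

(** Metric compatibility splits the derivative of the Gram matrix in w(X_c) = \sum_a g_(ca) w^a into
    two Christoffel terms: one completes the covariant derivative of w, the other is w applied to
    the derivative of X_c. *)
Lemma nabla_form_ofield b c :
  nabla_ad A x (row b (onb g x)) (fun y => w y (fun=> ofield c y)) =
  cov_deriv b c + \sum_a gdot g x (christoffel b c) (row a (onb g x)) *: coeff a x.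
Proof.
have e : \near x, w x (fun=> ofield c x) = \sum_a gram x c a *: coeff a x.
  by apply: filterS near_dom => y; exact: form_ofield.
rewrite (near_eq_nabla_ad A _ e) nabla_ad_sum => [|a]; last first.
  by apply: diff_ad_scale; [exact: diff_gram|exact: diff_ad_coeff].
under eq_bigr => a _.
  rewrite (nabla_ad_scale A _ (diff_gram c a) (diff_ad_coeff a)) dir_deriv_gram.
  rewrite gram_id mxE scalerDl -addrA addrC.
  over.
rewrite !big_split /= /cov_deriv [X in X + _ = _]addrC; congr (_ + _ + _).
rewrite (bigD1 c) //= eqxx scale1r big1 ?addr0 // => a ac.
by rewrite eq_sym (negbTE ac) scale0r.
Qed.

Lemma dA_one_form b c :
  dA A w x (fun i => row (fun2 b c i) (onb g x)) = cov_deriv b c - cov_deriv c b.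
Proof.
rewrite /dA big_ord_recl.
rewrite big_ord1.
have e (h : 'I_n) (f : 'I_1 -> 'I_n) : f 0 = h ->
    (fun y => w y (fun j => row (f j) (onb g x) *m tframe x y)) =
    fun y => w y (fun=> ofield h y).
  by move=> <-; apply/funext => y; congr (w y _); apply/funext => j; rewrite ord1.
rewrite (e c (fun j => fun2 b c (lift ord0 j))) //.
rewrite (e b (fun j => fun2 b c (lift (lift ord0 ord0) j))) //.
rewrite [X in X *: _](_ : _ = 1) // scale1r.
rewrite [X in X *: _](_ : _ = -1) // scaleN1r.
have -> : fun2 b c ord0 = b by [].
have -> : fun2 b c (lift ord0 ord0) = c by [].
(* The terms w(nabla_b X_c) and w(nabla_c X_b) cancel, the connection being torsion free. *)
by rewrite !nabla_form_ofield (christoffel_sym c b) opprD addrACA subrr addr0.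
Qed.

End OneForms.

(** * Hodge dual of a one-form *)

Section HodgeDual.
Context {R : realType} {k m : nat} {M : manifold R k.+1} {G : lie_group R m}.
Context {PP : principal_bundle M G} (A : principal_connection PP).
Context (g : oriented_riemannian M) (D : levi_civita g).
Context (w : M -> ('I_1 -> 'rV[R]_k.+1) -> 'rV[R]_m) (w_form : ad_form PP w).
Variable x : M.

(** The volume form evaluated on the coordinate frame [oframe], the classical density sqrt(det
    g). *)
Definition vol_ratio (y : M) : R^o :=
  \det (onb g x) * (\det (tframe x y) / \det (onb g y)).

(** The squares agree because [det_metric] gives the metric determinant as [det (onb g y)] to the
    power -2; [onb_oriented] makes the ratio positive. Differentiability of the ratio can only come
    from the left side. *)
Lemma vol_ratioE : \forall y \near x, Num.sqrt (\det (gram g x y)) = vol_ratio y.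
Proof.
apply: filterS (onb_oriented g x) => y h.
have u z : \det (onb g z) != 0 by rewrite -unitfE -unitmxE onb_unit.
have v0 : 0 < vol_ratio y.
  have : 0 < (\det (onb g x) * \det (onb g y) * \det (tframe x y)) *
    (\det (onb g y) ^+ 2)^-1.
    by rewrite mulr_gt0 // invr_gt0 exprn_even_gt0 //= u.
  congr (_ < _); rewrite /vol_ratio; have := u y => uy.
  by field.
have -> : \det (gram g x y) = vol_ratio y ^+ 2.
  rewrite /gram /oframe !det_mulmx det_tr det_mulmx det_metric /vol_ratio.
  have := u y => uy; by field.
by rewrite sqrtr_sqr gtr0_norm.
Qed.

Lemma diff_det_gram : diff_at (fun y => \det (gram g x y) : R^o) x.
Proof. by apply: diff_at_det => i j; exact: diff_gram. Qed.

Let sqrt1 : is_derive (1 : R) 1 Num.sqrt ((2 * Num.sqrt (1 : R))^-1).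
Proof. exact: is_derive1_sqrt. Qed.

Let diff_sqrt1 : differentiable (Num.sqrt : R^o -> R^o) (1 : R^o).
Proof. by apply/derivable1_diffP; have [] := sqrt1. Qed.

Lemma diff_vol_ratio : diff_at vol_ratio x.
Proof.
apply: (near_eq_diff_at vol_ratioE).
apply: (@diff_at_comp _ _ _ (Num.sqrt : R^o -> R^o)); last exact: diff_det_gram.
by rewrite gram_id det1.
Qed.

Lemma vol_ratio_id : vol_ratio x = 1.
Proof. by rewrite -(nbhs_singleton vol_ratioE) gram_id det1 sqrtr1. Qed.

(** The square of the ratio is the Gram determinant. At x, where the ratio is 1, this gives twice
    the derivative as the trace of the derivative of [gram], each diagonal entry of which is twice a
    Christoffel term. *)
Lemma dir_deriv_vol_ratio a :
  dir_deriv x (row a (onb g x)) vol_ratio =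
  \sum_c gdot g x (christoffel D x a c) (row c (onb g x)).
Proof.
have e : \forall y \near x, (vol_ratio y * vol_ratio y : R^o) = \det (gram g x y).
  apply: filterS2 vol_ratioE (near_cdom (chart_at_dom x)) => y <- xy.
  rewrite -expr2 sqr_sqrtr // /gram /oframe !det_mulmx det_tr det_mulmx det_metric.
  have -> : forall a b c : R, a * b * c * (a * b) = (a * b) ^+ 2 * c by move=> *; ring.
  by rewrite mulr_ge0 ?sqr_ge0 // invr_ge0 sqr_ge0.
have := near_eq_dir_deriv (row a (onb g x)) e.
rewrite dir_derivM ?vol_ratio_id; [|exact: diff_vol_ratio|exact: diff_vol_ratio].
rewrite dir_deriv_det1 ?gram_id; [|move=> i j; exact: diff_gram|by []].
under eq_bigr do rewrite (dir_deriv_gram D).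
rewrite big_split /= mulr1 mul1r => h.
by move: h; set u := dir_deriv _ _ _; set z := \sum_c _ => h; lra.
Qed.

(** After the change of basis the determinants are constant in y; all dependence on y sits in the
    density times the components of epsilon. *)
Lemma near_hodge1 (v : 'I_k -> 'rV[R]_k.+1) :
  \forall y \near x, hodge1 g w y (fun j => v j *m tframe x y) =
  \sum_a \det (replace_row0 (delta_mx 0 a) (fun j => v j *m invmx (onb g x))) *:
    (vol_ratio y *: coeff g w x a y).
Proof.
apply: filterS (near_cdom (chart_at_dom x)) => y xy.
pose v' (j : 'I_k) := v j *m tframe x y.
have -> : hodge1 g w y v' = \det (invmx (onb g y)) *:
    \sum_a \det (replace_row0 (row a (onb g y)) v') *: w y (fun=> row a (onb g y)).
  rewrite scaler_sumr; apply: eq_bigr => a _; rewrite scalerA; congr (_ *: _).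
  by rewrite mulrC -det_mulmx.
rewrite sum_det_replace_row0 -(sharp_onb g w_form) (sharp_ofield g w_form xy).
rewrite -sum_det_replace_row0 scaler_sumr; apply: eq_bigr => a _.
rewrite !scalerA; congr (_ *: _).
have -> : replace_row0 (ofield g x a y) v' =
    replace_row0 (delta_mx 0 a) (fun j => v j *m invmx (onb g x)) *m
    onb g x *m tframe x y.
  rewrite !replace_row0_mul -rowE; congr (replace_row0 _ _).
  by apply/funext => j; rewrite mulmxKV // onb_unit.
by rewrite !det_mulmx det_inv /vol_ratio; ring.
Qed.

Let F a y := vol_ratio y *: coeff g w x a y.

Let diff_F a : diff_ad (P := PP) (F a) x.
Proof. by apply: diff_ad_scale; [exact: diff_vol_ratio|exact: diff_ad_coeff]. Qed.

(** The classical formula for the divergence by means of sqrt(det g): the derivative of the density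
    supplies the contracted Christoffel term, once its lower indices are exchanged by symmetry. *)
Lemma divergence_F :
  \sum_a nabla_ad A x (row a (onb g x)) (F a) = \sum_a cov_deriv A D w x a a.
Proof.
under eq_bigr => a _.
  rewrite (nabla_ad_scale A _ diff_vol_ratio (diff_ad_coeff g w_form x a)).
  rewrite vol_ratio_id scale1r dir_deriv_vol_ratio addrC scaler_suml.
  over.
rewrite /cov_deriv !big_split /=; congr (_ + _).
rewrite [RHS]exchange_big; apply: eq_bigr => a _; apply: eq_bigr => c _ /=.
by rewrite christoffel_sym.
Qed.

(** With C the components of the v_i in the basis at x, the Koszul sum produces \sum_i cofactor(i,
    a) C(i, b), which is det C for a = b and 0 otherwise; only the divergence survives. *)
Lemma dA_hodge1 (v : 'I_k.+1 -> 'rV[R]_k.+1) :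
  dA A (hodge1 g w) x v =
  \det ((\matrix_i v i) *m invmx (onb g x)) *: \sum_a cov_deriv A D w x a a.
Proof.
pose C := (\matrix_i v i) *m invmx (onb g x).
have rowC i : v i *m invmx (onb g x) = row i C by rewrite row_mul rowK.
have vC i : v i = \sum_b C i b *: row b (onb g x).
  rewrite -[LHS](mulmxKV (onb_unit g x)) rowC mulmx_sum_row.
  by apply: eq_bigr => b _; rewrite mxE.
have nE (i : 'I_k.+1) : (-1) ^+ i *: nabla_ad A x (v i)
      (fun y => hodge1 g w y (fun j => v (lift i j) *m tframe x y)) =
    \sum_a \sum_b (cofactor C i a * C i b) *: nabla_ad A x (row b (onb g x)) (F a).
  rewrite (near_eq_nabla_ad A (v i) (near_hodge1 (fun j => v (lift i j)))).
  rewrite nabla_ad_sum; last first.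
    by move=> a; apply: diff_ad_scale; [exact: diff_at_cst|exact: diff_F].
  rewrite scaler_sumr; apply: eq_bigr => a _.
  rewrite (@nabla_ad_scale _ _ _ _ _ _ A (fun=> _)); [|exact: diff_at_cst|exact: diff_F].
  rewrite dir_deriv_cst scale0r add0r scalerA -/(F a) {1}vC nabla_ad_dir_sum //.
  rewrite scaler_sumr; apply: eq_bigr => b _; rewrite scalerA; congr (_ * _ *: _).
  rewrite -cofactor_replace_row0; congr (_ * \det (replace_row0 _ _)).
  by apply/funext => j; rewrite rowC.
rewrite /dA (eq_bigr _ (fun i _ => nE i)) exchange_big -divergence_F scaler_sumr.
apply: eq_bigr => a _; rewrite exchange_big /=.
have h b : \sum_(i < k.+1) (cofactor C i a * C i b) *:
      nabla_ad A x (row b (onb g x)) (F a) =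
    (\det C *+ (a == b)) *: nabla_ad A x (row b (onb g x)) (F a).
  by rewrite -sum_cofactor scaler_suml.
rewrite (eq_bigr _ (fun b _ => h b)) (bigD1 a) //= eqxx big1 ?addr0 // => b ba.
by rewrite eq_sym (negbTE ba) scale0r.
Qed.

End HodgeDual.

(** * Clifford action of forms *)

Section CliffordAction.
Context {R : realType} {M : manifold R 6} {g : oriented_riemannian M}.
Variable S : spinor_bundle g.
Implicit Types x y : M.

Definition gamma x (i : 'I_6) : 'M[R]_8 := clif S x (row i (onb g x)).

Lemma gamma_sq x i : gamma x i * gamma x i = -1.
Proof. by rewrite -mulmxE clif_sq gdot_onb eqxx. Qed.

Lemma gamma_skew x i : (gamma x i)^T = - gamma x i.
Proof. exact: clif_skew. Qed.

Lemma gamma_anti x i j : i != j -> gamma x i * gamma x j = - (gamma x j * gamma x i).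
Proof.
move=> ij; apply/eqP; rewrite -addr_eq0; apply/eqP.
(* The Clifford relation on the sum of two orthonormal vectors, of square length 2, polarizes to
   anticommutation. *)
have := clif_sq S x (row i (onb g x) + row j (onb g x)).
rewrite linearD mulmxE mulrDl !mulrDr -/(gamma x i) -/(gamma x j) !gamma_sq.
have -> : gdot g x (row i (onb g x) + row j (onb g x))
    (row i (onb g x) + row j (onb g x)) = 2.
  rewrite /gdot linearD /= !mulmxDl !mulmxDr.
  have h a b : (row a (onb g x) *m metric g x *m (row b (onb g x))^T) 0 0 = (a == b)%:R.
    exact: gdot_onb.
  have mD (B C : 'M[R]_1) : (B + C) 0 0 = B 0 0 + C 0 0 by rewrite mxE.
  by rewrite !mD !h !eqxx (eq_sym j) (negbTE ij) addr0 add0r.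
have -> : - (2%:M) = -1 + -1 :> 'M[R]_8.
  by rewrite -scalemx1 scaler_nat mulr2n opprD.
by rewrite [gamma x j * _ + _]addrC addrACA -[RHS]addr0 => /addrI.
Qed.

Lemma cl_formE k x (w : ('I_k -> 'rV[R]_6) -> R) :
  cl_form S x w = \sum_(a : {ffun 'I_k -> 'I_6} | incr a)
    w (fun i => row (a i) (onb g x)) *: \prod_(i < k) gamma x (a i).
Proof. by []. Qed.

Lemma cl_actE k m x (w : ('I_k -> 'rV[R]_6) -> 'rV[R]_m) (eta : 'cV[R]_8) :
  cl_act S x w eta = \sum_(a : {ffun 'I_k -> 'I_6} | incr a)
    (\prod_(i < k) gamma x (a i)) *m (eta *m w (fun i => row (a i) (onb g x))).
Proof.
rewrite /cl_act; under eq_bigr do rewrite cl_formE !mulmx_suml.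
rewrite exchange_big; apply: eq_bigr => a _ /=.
rewrite {2}(row_sum_delta (w _)) !mulmx_sumr; apply: eq_bigr => j _.
by rewrite -scalemxAr -scalemxAr -!scalemxAl !mulmxA.
Qed.

Lemma cl_act1E m x (w : ('I_1 -> 'rV[R]_6) -> 'rV[R]_m) (eta : 'cV[R]_8) :
  cl_act S x w eta =
  \sum_a gamma x a *m (eta *m w (fun=> row a (onb g x))).
Proof.
rewrite cl_actE sum_incr1; apply: eq_bigr => a _; rewrite big_ord1 ffunE.
by congr (_ *m (_ *m w _)); apply/funext => i; rewrite ffunE.
Qed.

Lemma cl_act2E m x (w : ('I_2 -> 'rV[R]_6) -> 'rV[R]_m) (eta : 'cV[R]_8) :
  cl_act S x w eta = \sum_(b < 6) \sum_(c < 6 | (b < c)%N)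
    (gamma x b * gamma x c) *m (eta *m w (fun i => row (fun2 b c i) (onb g x))).
Proof.
rewrite cl_actE sum_incr2; apply: eq_bigr => b _; apply: eq_bigr => c _.
rewrite !big_ord_recl big_ord0 mulr1 !ffunE.
by congr (_ *m (_ *m w _)); apply/funext => i; rewrite ffunE.
Qed.

Lemma quadratic_cl_act2 m x (w : ('I_2 -> 'rV[R]_6) -> 'rV[R]_m) (eta : 'cV[R]_8) :
  eta^T *m cl_act S x w eta = 0.
Proof.
rewrite cl_act2E mulmx_sumr big1 // => b _; rewrite mulmx_sumr big1 // => c bc.
rewrite !mulmxA -(mulmxA eta^T) quadratic_skew ?mul0mx //.
rewrite mulmxE clifford_pair_skew //; [exact: gamma_anti|exact: gamma_skew|].
by apply: contraTneq bc => ->; rewrite ltnn.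
Qed.

(** The constant is the degree of the form. For distinct indices both T and the product of gammas
    are antisymmetric, so their product is symmetric and [sum_symmetric3] applies. *)
Lemma sum_gamma_contract x (T : ('I_3 -> 'rV[R]_6) -> R^o) : Defs.alternating T ->
  \sum_(b < 6) gamma x b *m cl_form S x (Defs.contract (row b (onb g x)) T) =
  3 *: cl_form S x T.
Proof.
move=> altT.
pose r i := row i (onb g x).
pose Y i j k : 'M[R]_8 := T (fun3 (r i) (r j) (r k)) *: (gamma x i * gamma x j * gamma x k).
have rE (v : 'I_3 -> 'I_6) i j k : v = fun3 i j k ->
    (fun l => row (v l) (onb g x)) = fun3 (r i) (r j) (r k).
  by move=> ->; apply/funext; apply: ord3P.
have cE b i j : Defs.contract (r b) T (fun l => row (finfun (fun2 i j) l) (onb g x)) =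
    T (fun3 (r b) (r i) (r j)).
  rewrite /Defs.contract; congr (T _); apply/funext; apply: ord3P.
  - by rewrite unlift_none.
  - by rewrite (_ : 1 = lift ord0 0) ?liftK /= ?ffunE //; exact/val_inj.
  - by rewrite (_ : o2 = lift ord0 1) ?liftK /= ?ffunE //; exact/val_inj.
have -> : cl_form S x T = \sum_(i < 6) \sum_(j < 6 | (i < j)%N)
    \sum_(k < 6 | (j < k)%N) Y i j k.
  rewrite cl_formE sum_incr3; apply: eq_bigr => i _; apply: eq_bigr => j _.
  apply: eq_bigr => k _; rewrite !big_ord_recl big_ord0 mulr1 !ffunE mulrA.
  rewrite /Y; congr (T _ *: _); rewrite -(rE (finfun (fun3 i j k))) //.
  by apply/funext => l; rewrite ffunE.
rewrite scaler_nat -sum_symmetric3; last 3 first.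
- move=> i j k; have [->//|ij] := eqVneq i j.
  by rewrite /Y (alternating3_swap01 altT) (gamma_anti x ij) mulNr scalerN scaleNr opprK.
- move=> i j k; have [->//|jk] := eqVneq j k.
  rewrite /Y (alternating3_swap12 altT) -!mulrA (gamma_anti x jk).
  by rewrite mulrN scalerN scaleNr opprK.
- by move=> i k; rewrite /Y (alternating3_eq0 altT) scale0r.
apply: eq_bigr => b _; rewrite cl_formE sum_incr2 mulmx_sumr.
apply: eq_bigr => i _; rewrite mulmx_sumr; apply: eq_bigr => j _.
rewrite cE -scalemxAr /Y !big_ord_recl big_ord0 mulr1 !ffunE.
by rewrite mulmxE mulrA.
Qed.

(** The counterpart of [sum_det_replace_row0] for the Clifford action: only the tensor built from f
    and s matters. *)
Lemma sum_clif (I : finType) m x (f : I -> 'rV[R]_6) (s : I -> 'rV[R]_m) (eta : 'cV[R]_8) :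
  \sum_a clif S x (f a) *m (eta *m s a) =
  \sum_l clif S x (delta_mx 0 l) *m (eta *m row l (\sum_a (f a)^T *m s a)).
Proof.
under [RHS]eq_bigr do rewrite linear_sum /= !mulmx_sumr.
rewrite exchange_big; apply: eq_bigr => a _ /=.
rewrite {1}(row_sum_delta (f a)) linear_sum mulmx_suml; apply: eq_bigr => l _.
rewrite linearZ -scalemxAl !scalemxAr; congr (_ *m (_ *m _)).
by apply/rowP => j; rewrite !mxE big_ord1 !mxE.
Qed.

End CliffordAction.

(** * The Dirac operator *)

Section DiracOperator.
Context {R : realType} {M : manifold R 6} (g : oriented_riemannian M).
Context {D : levi_civita g} {S : spinor_bundle g} (N : spin_connection S D).
Context {psi : M -> 'cV[R]_8} (psi_smooth : forall x, smooth_spinor S psi x).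
Hypothesis psi_killing : forall x v, N x v psi = 2^-1 *: (clif S x v *m psi x).
Context {m : nat} {G : lie_group R m} {PP : principal_bundle M G}.
Variable A : principal_connection PP.
Context {w : M -> ('I_1 -> 'rV[R]_6) -> 'rV[R]_m} (w_form : ad_form PP w).
Variables (t : R) (T : M -> ('I_3 -> 'rV[R]_6) -> R) (x : M).
Hypothesis altT : Defs.alternating (T x : _ -> R^o).

Let Xi y := cl_act S y (w y) (psi y).

Lemma cl_act_ofield :
  \forall y \near x, Xi y =
  \sum_a (clif S y (ofield g x a y) *m psi y) *m coeff g w x a y.
Proof.
apply: filterS (near_cdom (chart_at_dom x)) => y xy.
rewrite /Xi cl_act1E sum_clif -(sharp_onb g w_form) (sharp_ofield g w_form xy).
by rewrite -sum_clif; apply: eq_bigr => a _; rewrite mulmxA.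
Qed.

Lemma nabla_tA_cl_act b :
  nabla_tA N t T A x (row b (onb g x)) Xi =
  \sum_c gamma S x c *m (psi x *m cov_deriv A D w x b c) +
  \sum_a 2^-1 *: ((gamma S x a * gamma S x b) *m (psi x *m coeff g w x a x)) +
  (t / 4) *: (cl_form S x (Defs.contract (row b (onb g x)) (T x : _ -> R^o)) *m Xi x).
Proof.
have sY a : smooth_field (ofield g x a) x by exact: smooth_coord_field.
rewrite (nabla_tA_leibniz N A t T (row b (onb g x))
  (fun a => smooth_spinor_clif (sY a) (psi_smooth x))
  (diff_ad_coeff g w_form x) cl_act_ofield); congr (_ + _).
under [LHS]eq_bigr => a _.
  rewrite (snab_clif N) // psi_killing ofield_id -/(christoffel D x b a).
  rewrite -/(gamma S x a) -/(gamma S x b) mulmxDl -scalemxAr -scalemxAl.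
  rewrite (mulmxA (gamma S x a)) mulmxE -!mulmxA addrAC.
  over.
rewrite big_split /=; congr (_ + _); last first.
  by apply: eq_bigr => a _; rewrite mulmxA mulmxE.
rewrite /cov_deriv.
under [RHS]eq_bigr do rewrite !mulmxDr.
rewrite !big_split /= addrC; congr (_ + _).
under [RHS]eq_bigr do rewrite !mulmx_sumr.
rewrite exchange_big; apply: eq_bigr => a _ /=.
(* Expanding nabla_b e_a in the basis e_c moves its Clifford action onto e_c.psi, where its
   coefficients are the Christoffel part of [cov_deriv]. *)
rewrite {1}(gdot_onb_sum g x (christoffel D x b a)) linear_sum mulmx_suml.
apply: eq_bigr => c _; rewrite linearZ -scalemxAl -/(gamma S x c).
by rewrite !scalemxAr.
Qed.

Lemma dirac_op_cl_act :
  dirac_op N t T A Xi x =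
  cl_act S x (dA A w x) (psi x) -
  psi x *m (\sum_b cov_deriv A D w x b b) + 2 *: Xi x +
  (t / 4) *: (3 *: (cl_form S x (T x) *m Xi x)).
Proof.
rewrite /dirac_op; under eq_bigr do rewrite -/(gamma S x _) nabla_tA_cl_act !mulmxDr.
rewrite [LHS]big_split /= [X in X + _ = _]big_split /=; congr (_ + _ + _).
- under eq_bigr => b _.
    rewrite mulmx_sumr; under eq_bigr do rewrite mulmxA mulmxE.
    over.
  rewrite (clifford_split (gamma_sq S x) (@gamma_anti _ _ _ S x)
    (fun b c => psi x *m cov_deriv A D w x b c)).
  rewrite mulmx_sumr; congr (_ - _).
  rewrite cl_act2E; apply: eq_bigr => b _; apply: eq_bigr => c _.
  by rewrite (dA_one_form A D w_form) (mulmxBr (psi x)).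
- under eq_bigr do rewrite mulmx_sumr.
  rewrite exchange_big (nbhs_singleton cl_act_ofield) scaler_sumr.
  apply: eq_bigr => a _ /=.
  under eq_bigr do rewrite -scalemxAr (mulmxA (gamma S x _)) mulmxE mulrA.
  rewrite -scaler_sumr -mulmx_suml clifford_sandwich;
    [|exact: gamma_sq|exact: gamma_anti].
  rewrite -scalemxAl scalerA ofield_id -/(gamma S x a) mulmxA.
  by congr (_ *: _); field.
- under eq_bigr do rewrite -scalemxAr mulmxA.
  by rewrite -scaler_sumr -mulmx_suml sum_gamma_contract // -scalemxAl.
Qed.

End DiracOperator.

Theorem proposition2 (R : realType) (X : nearly_kahler R)
    (P : X -> ('I_3 -> 'rV[R]_6) -> R) (Q : X -> ('I_4 -> 'rV[R]_6) -> R)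
    (hPQ : nk_forms P Q)
    (m : nat) (G : lie_group R m) (PP : principal_bundle X G)
    (A : principal_connection PP)
    (eps : X -> ('I_1 -> 'rV[R]_6) -> 'rV[R]_m) (heps : ad_form PP eps)
    (t : R) :
  ((forall x : X, cl_act (nk_spin X) x (dA A eps x) (nk_psi x) = 0) /\
   (forall (x : X) (v : 'I_6 -> 'rV[R]_6), dA A (hodge1 (nk_metric X) eps) x v = 0))
  <->
  (forall x : X,
     dirac_op (nk_snab X) t P A (fun y => cl_act (nk_spin X) y (eps y) (nk_psi y)) x =
     2 *: cl_act (nk_spin X) x (eps x) (nk_psi x)).
Proof.
pose g := nk_metric X; pose S := nk_spin X.
pose div x := \sum_b cov_deriv A (nk_lc X) eps x b b.
have torsion x : cl_form S x (P x) *m cl_act S x (eps x) (nk_psi x) = 0.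
  have [_ _ psiE] := hPQ x.
  rewrite cl_act1E mulmx_sumr big1 // => a _; rewrite mulmxA (mulmxA (_ *m _)).
  rewrite -(mulmxA (cl_form _ _ _)) cl_formE.
  (* Q has degree 4, which is [2.*2]; each summand of epsilon.psi starts from a spinor e_a.psi. *)
  by rewrite (clifford_three_form_eq0 (k := 2) (gamma_sq S x)
    (@gamma_anti _ _ _ S x) (@gamma_skew _ _ _ S x) psiE) mul0mx.
have dirac x : dirac_op (nk_snab X) t P A
      (fun y => cl_act S y (eps y) (nk_psi y)) x =
    cl_act S x (dA A eps x) (nk_psi x) - nk_psi x *m div x +
    2 *: cl_act S x (eps x) (nk_psi x).
  have [altP _ _] := hPQ x.
  rewrite (dirac_op_cl_act (@nk_psi_smooth _ X) (@nk_killing _ X) A heps t altP).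
  by rewrite torsion !scaler0 addr0.
have hodge x v : dA A (hodge1 g eps) x v =
    \det ((\matrix_i v i) *m invmx (onb g x)) *: div x.
  exact: (dA_hodge1 A (nk_lc X) heps).
split=> [[dA0 hodge0] x|dirac0].
  have div0 : div x = 0.
    (* On the oriented orthonormal basis at x the volume factor is 1, which isolates the
       divergence. *)
    have := hodge x (fun i => row i (onb g x)); rewrite hodge0.
    have -> : \matrix_i row i (onb g x) = onb g x.
      by apply/row_matrixP => i; rewrite rowK.
    by rewrite mulmxV ?onb_unit // det1 scale1r.
  by rewrite dirac dA0 div0 mulmx0 subr0 add0r.
have eq0 x : cl_act S x (dA A eps x) (nk_psi x) = nk_psi x *m div x.
  have := dirac x; rewrite dirac0 => /eqP.
  by rewrite -[X in X == _]add0r (inj_eq (addIr _)) eq_sym subr_eq0 => /eqP.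
have div0 x : div x = 0.
  (* Pairing with psi kills d^A epsilon.psi and, psi having length one, returns the divergence
     itself. *)
  have := quadratic_cl_act2 S x (dA A eps x) (nk_psi x).
  by rewrite eq0 mulmxA nk_psi_unit mul1mx.
split=> [x|x v]; first by rewrite eq0 div0 mulmx0.
by rewrite hodge div0 scaler0.
Qed.
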